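(* Let $k>1$ be a natural number and let $A(T,\mathbf{x},z)\in\mathbb{F}[T,\mathbf{x},z]$ and $\Phi(T,\mathbf{x})\in\mathbb{F}[T,\mathbf{x}]$, $\mathbf{x}=(x_1,\dots,x_n)$, satisfy: (i) $A$ is computable by a depth-$\Delta$ circuit of size $s$; (ii) $A$ is $T$-regularized and monic in $z$; (iii) $\Phi$ is a truncated, non-degenerate, approximate $z$-root of $A$ of order $k$; (iv) $A(T,\mathbf{x},\Phi(T,\mathbf{x}))$ is not identically zero. Let $\mathcal{S}$ be an $(n,\sigma,\mu,\rho)$-design and $g$ a $\sigma$-variate polynomial of degree $d$, and let $\mathbf{w}$ be a tuple of $\mu$ new variables. If $A(T,\mathbf{KI}_{g,\mathcal{S}}(\mathbf{w}),\Phi(T,\mathbf{KI}_{g,\mathcal{S}}(\mathbf{w})))$ is identically zero, then $g$ can be computed by an algebraic circuit of depth $\Delta'=\Delta+O(1)$ and size $s'\le \mathrm{poly}(s,\deg(A),k)\cdot(\rho\log k)^{\mathrm{poly}(d)}$. In particular, if $g$ cannot be computed by a circuit of size $s'$ and depth $\Delta'$, then $A(T,\mathbf{KI}_{g,\mathcal{S}}(\mathbf{w}),\Phi(T,\mathbf{KI}_{g,\mathcal{S}}(\mathbf{w})))$ is identically zero if and only if $A(T,\mathbf{x},\Phi(T,\mathbf{x}))$ is identically zero.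
   Context: $\mathbb{F}$ is a field of characteristic zero (e.g. $\mathbb{Q}$); the $O(1)$ and $\mathrm{poly}$ are absolute. Circuits: unbounded fan-in sum/product gates, size = edges, depth = longest path. $A$ is monic in $z$ if the leading coefficient in $z$ is a nonzero constant; $A$ is $T$-regularized if $A(0,\mathbf{x},z)\in\mathbb{F}[z]$. $\Phi$ is an approximate $z$-root of order $k$ (with respect to $T$) if $A(T,\mathbf{x},\Phi)\equiv0\bmod T^k$; truncated if $\deg_T\Phi<k$; non-degenerate if $(\partial_zA)(0,\mathbf{0},\Phi(0,\mathbf{0}))\ne0$. An $(n,\sigma,\mu,\rho)$-design is $S_1,\dots,S_n\subseteq[\mu]$ with $|S_i|=\sigma$, $|S_i\cap S_j|<\rho$ for $i\neq j$. $\mathbf{KI}_{g,\mathcal{S}}(\mathbf{w})=(g(\mathbf{w}_{S_1}),\dots,g(\mathbf{w}_{S_n}))$ where $\mathbf{w}_{S_i}=(w_j)_{j\in S_i}$; composition substitutes $x_i\mapsto g(\mathbf{w}_{S_i})$. *)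

(* Defs.v *)
From HB Require Import structures.
From mathcomp Require Import all_boot all_order all_algebra.
From mathcomp.multinomials Require Export mpoly.

Set Implicit Arguments.
Unset Strict Implicit.
Unset Printing Implicit Defensive.

Import GRing.Theory.
Local Open Scope ring_scope.

(* A circuit is a DAG listed in topological order: the seq nat carried by a sum
   or product gate holds the positions of its children, one entry per incoming
   edge (with repetitions for parallel edges).  The last gate is the output. *)
Inductive gate (F : Type) (m : nat) : Type :=
| Input of 'I_m
| Const of F
| SumGate of seq nat
| ProdGate of seq nat.

Arguments Input {F m}.
Arguments Const {F m}.
Arguments SumGate {F m}.
Arguments ProdGate {F m}.

Definition circuit (F : Type) (m : nat) := seq (gate F m).

Definition children F m (u : gate F m) : seq nat :=
  match u with
  | SumGate l | ProdGate l => l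
  | _ => [::]
  end.

Definition wf_circuit F m (C : circuit F m) : Prop :=
  (0 < size C)%N /\
  forall (C1 C2 : circuit F m) (u : gate F m),
    C = C1 ++ u :: C2 -> all (fun j => j < size C1)%N (children u).

Definition gate_value (F : fieldType) m (vals : seq {mpoly F[m]}) (u : gate F m)
    : {mpoly F[m]} :=
  match u with
  | Input i => 'X_i
  | Const c => c%:MP
  | SumGate l => \sum_(j <- l) nth 0 vals j
  | ProdGate l => \prod_(j <- l) nth 0 vals j
  end.

Definition circuit_values (F : fieldType) m (C : circuit F m)
    : seq {mpoly F[m]} :=
  foldl (fun vals u => rcons vals (gate_value vals u)) [::] C.

Definition circuit_output (F : fieldType) m (C : circuit F m) : {mpoly F[m]} :=
  last 0 (circuit_values C).

Definition circuit_size F m (C : circuit F m) : nat :=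
  sumn [seq size (children u) | u <- C].

(* The number of edges of a longest path ending at each gate. *)
Definition gate_depths F m (C : circuit F m) : seq nat :=
  foldl (fun ds u => rcons ds (\max_(j <- children u) (nth 0 ds j).+1)%N) [::] C.

Definition circuit_depth F m (C : circuit F m) : nat :=
  \max_(e <- gate_depths C) e.

Definition computable (F : fieldType) m (Delta s : nat) (p : {mpoly F[m]})
    : Prop :=
  exists C : circuit F m,
    [/\ wf_circuit C, circuit_output C = p,
        (circuit_depth C <= Delta)%N & (circuit_size C <= s)%N].

(* Equal to 0 on the zero polynomial. *)
Definition tdeg (F : fieldType) m (p : {mpoly F[m]}) : nat := (msize p).-1.

(* F[T, x_1, ..., x_n, z] is {mpoly F[n.+2]}, with T the first variable and z the
   last one.  subst3 iota t x y A is A(t, x, y) in a ring R that contains F via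
   iota. *)
Definition zvar n : 'I_n.+2 := ord_max.

Definition subst3 (F : fieldType) n (R : comNzRingType) (iota : {rmorphism F -> R})
    (t : R) (x : 'I_n -> R) (y : R) (A : {mpoly F[n.+2]}) : R :=
  mmap iota
    (fun i : 'I_n.+2 =>
       if unlift ord0 i is Some j then
         if unlift ord_max j is Some l then x l else y
       else t) A.

(* A as an element of F[x][T][z]. *)
Definition zpoly (F : fieldType) n (A : {mpoly F[n.+2]})
    : {poly {poly {mpoly F[n]}}} :=
  subst3 (polyC \o polyC \o @mpolyC n F) 'X%:P (fun i => ('X_i)%:P%:P) 'X A.

Definition monic_in_z (F : fieldType) n (A : {mpoly F[n.+2]}) : Prop :=
  exists2 c : F, c != 0 & lead_coef (zpoly A) = c%:MP%:P.

Definition T_regularized (F : fieldType) n (A : {mpoly F[n.+2]}) : Prop :=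
  exists P : {poly F},
    subst3 (polyC \o @mpolyC n F) 0 (fun i => ('X_i)%:P) 'X A
      = map_poly (@mpolyC n F) P.

(* Polynomials in F[T, x] are taken in F[x][T]. *)
Definition subst_root (F : fieldType) n (A : {mpoly F[n.+2]})
    (Phi : {poly {mpoly F[n]}}) : {poly {mpoly F[n]}} :=
  subst3 (polyC \o @mpolyC n F) 'X (fun i => ('X_i)%:P) Phi A.

Definition approx_root (F : fieldType) n (k : nat) (A : {mpoly F[n.+2]})
    (Phi : {poly {mpoly F[n]}}) : Prop :=
  exists Q : {poly {mpoly F[n]}}, subst_root A Phi = Q * 'X^k.

Definition truncated_root (F : fieldType) n (k : nat) (Phi : {poly {mpoly F[n]}})
    : Prop := (size Phi <= k)%N.

Definition nondegenerate_root (F : fieldType) n (A : {mpoly F[n.+2]})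
    (Phi : {poly {mpoly F[n]}}) : Prop :=
  subst3 idfun 0 (fun=> 0) (Phi.[0]).@[fun=> 0] (A^`M(zvar n)) != 0.

Definition design n (sigma mu rho : nat) (S : 'I_n -> {set 'I_mu}) : Prop :=
  (forall i, #|S i| = sigma) /\
  (forall i j, i != j -> #|S i :&: S j| < rho)%N.

(* The tuple of the w_j for j in B, in increasing order of j; the default value
   of nth is never reached when #|B| = sigma. *)
Definition restr_vars (F : fieldType) (sigma mu : nat) (B : {set 'I_mu})
    : sigma.-tuple {mpoly F[mu]} :=
  [tuple nth 0 [seq ('X_j : {mpoly F[mu]}) | j <- enum B] t | t < sigma].

Definition KI (F : fieldType) n (sigma mu : nat) (g : {mpoly F[sigma]})
    (S : 'I_n -> {set 'I_mu}) : n.-tuple {mpoly F[mu]} :=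
  [tuple g \mPo restr_vars F sigma (S i) | i < n].

(* A(T, G(w), Phi(T, G(w))). *)
Definition subst_root_gen (F : fieldType) n mu (A : {mpoly F[n.+2]})
    (Phi : {poly {mpoly F[n]}}) (G : n.-tuple {mpoly F[mu]})
    : {poly {mpoly F[mu]}} :=
  subst3 (polyC \o @mpolyC mu F) 'X (fun i => (tnth G i)%:P)
    (map_poly (fun p => p \mPo G) Phi) A.

(* Generic polynomial bound: each polynomial in natural numbers a_1, ..., a_r
   with natural coefficients is at most (a_1 + ... + a_r + 2) ^ e for some e,
   and conversely each such power is a polynomial in the a_i. *)
Definition polyb (e a : nat) : nat := ((a + 2) ^ e)%N.

(* poly(s, D, k) * (rho * log k) ^ poly(d); the logarithm is floor (log_2 k),
   which is at least 1 for k > 1. *)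
Definition KI_size_bound (e s D k rho d : nat) : nat :=
  (polyb e (s + D + k) * (rho * trunc_log 2 k) ^ polyb e d)%N.

(* Main.v *)
(* Some coefficient f of T^j in A(T, x, Phi) is nonzero and vanishes on the
   generator.  The hybrid argument substitutes for all but one x_i restrictions of
   g to fewer than rho variables (or constants), leaving a nonzero f'(w, y) with
   f'(w, g(w)) = 0.  Replacing f' by a derivative in y makes g a simple root, so
   the part of degree at most d of g, that is g, is a polynomial of degree at most
   2d in the (d + 1)^2 low-degree Taylor coefficients of f' at (a + t w, g(a) + u).

   These Taylor coefficients have small circuits, although Phi itself need not.
   Along a line x = X(t), regularity and non-degeneracy make dA/dz at t = 0 a unit
   of F[T]/(T^k), so the coefficient of t^b in Phi(T, X(t)) is, modulo T^k, a
   polynomial of degree at most 2b - 1 in the coefficients of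
   A(T, X(t), Phi(T, X(0)) + u); these and the resulting coefficients of
   A(T, X(t), Phi(T, X(t))) are reached from circuits for A by interpolation.
   The same recursion with T in the role of t bounds the degree of Phi in x.

   If rho <= 1 the restrictions are constants, g is algebraic over F, hence
   constant. *)
Require Import Defs.
From mathcomp Require Import all_boot all_order all_algebra.
From mathcomp Require Import zify ring.
From Stdlib Require Import Classical_Prop.

Set Implicit Arguments.
Unset Strict Implicit.
Unset Printing Implicit Defensive.

Import GRing.Theory.
Local Open Scope ring_scope.

(** * Composition of circuits *)

Section Circuits.

Variable F : fieldType.

Definition gval m (V : nat -> {mpoly F[m]}) (u : gate F m) : {mpoly F[m]} :=
  match u with
  | Input i => 'X_i
  | Const c => c%:MP
  | SumGate l => \sum_(j <- l) V j
  | ProdGate l => \prod_(j <- l) V j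
  end.

Definition gate0 m : gate F m := Const 0.

Lemma eq_gval m (V V' : nat -> {mpoly F[m]}) u :
  {in children u, V =1 V'} -> gval V u = gval V' u.
Proof. by case: u => //= l eqV; apply: eq_big_seq => j /eqV. Qed.

Definition topological m (C : circuit F m) :=
  forall i j, (i < size C)%N -> j \in children (nth (gate0 m) C i) -> (j < i)%N.

(* [V] and [D] are witnesses of the values and depths of the gates of [C]. *)
Record annotated m (C : circuit F m) (V : nat -> {mpoly F[m]}) (D : nat -> nat)
    (Delta : nat) : Prop := Annotated {
  annot_topo : topological C;
  annot_val : forall i, (i < size C)%N -> V i = gval V (nth (gate0 m) C i);
  annot_depth : forall i j, (i < size C)%N ->
    j \in children (nth (gate0 m) C i) -> (D j < D i)%N;
  annot_bound : forall i, (i < size C)%N -> (D i <= Delta)%N }.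

Lemma wf_circuitP m (C : circuit F m) :
  wf_circuit C <-> (0 < size C)%N /\ topological C.
Proof.
split=> -[C_gt0 wfC]; split=> //.
  move=> i j ltiC jP; have := wfC (take i C) (drop i.+1 C) (nth (gate0 m) C i).
  rewrite -drop_nth // cat_take_drop => /(_ erefl) /allP /(_ _ jP).
  by rewrite size_take ltiC.
move=> C1 C2 u defC; apply/allP => j ju; apply: (wfC _ j).
  by rewrite defC size_cat /= addnS ltnS leq_addr.
by rewrite defC nth_cat ltnn subnn.
Qed.

Section Foldl.

Variables (m : nat) (T : Type) (x0 : T) (step : seq T -> gate F m -> T).
Hypothesis step_local : forall s s' u,
  {in children u, nth x0 s =1 nth x0 s'} -> step s u = step s' u.

Let run (C : circuit F m) := foldl (fun s u => rcons s (step s u)) [::] C.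

Lemma size_gate_run C : size (run C) = size C.
Proof.
by elim/last_ind: C => // C u IH; rewrite /run foldl_rcons !size_rcons IH.
Qed.

Lemma nth_gate_run C i : topological C -> (i < size C)%N ->
  nth x0 (run C) i = step (run C) (nth (gate0 m) C i).
Proof.
elim/last_ind: C i => // C u IH i topC.
have topC' : topological C.
  by move=> k j ltk; have := topC k j; rewrite size_rcons nth_rcons ltk ltnS ltnW // => /(_ isT).
have stepE s : step (run (rcons C u)) s = step (rcons (run C) (step (run C) u)) s.
  by rewrite /run foldl_rcons.
have sC := size_gate_run C.
rewrite size_rcons ltnS leq_eqVlt stepE /run foldl_rcons -/(run C) !nth_rcons sC.
case: (ltngtP i (size C)) => // [ltiC _|_ _].
  rewrite IH //; apply: step_local => j jP.
  by rewrite nth_rcons sC (ltn_trans (topC' _ _ ltiC jP) ltiC).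
apply: step_local => j ju; rewrite nth_rcons sC.
suff -> : (j < size C)%N by [].
by apply: topC; rewrite ?size_rcons // nth_rcons ltnn eqxx.
Qed.

End Foldl.

Lemma computableP m Delta s (p : {mpoly F[m]}) :
  computable Delta s p <->
  exists C V D, [/\ (0 < size C)%N, annotated C V D Delta,
                    V (size C).-1 = p & (circuit_size C <= s)%N].
Proof.
have val_local s1 s2 (u : gate F m) : {in children u, nth 0 s1 =1 nth 0 s2} ->
    gate_value s1 u = gate_value s2 u by exact: (@eq_gval m).
pose dstep (ds : seq nat) (u : gate F m) := (\max_(j <- children u) (nth 0 ds j).+1)%N.
have dep_local s1 s2 (u : gate F m) : {in children u, nth 0%N s1 =1 nth 0%N s2} ->
    dstep s1 u = dstep s2 u.
  by move=> eqs; rewrite /dstep; apply: eq_big_seq => j /eqs ->.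
have szV (C : circuit F m) : size (circuit_values C) = size C.
  exact: size_gate_run.
have szD (C : circuit F m) : size (gate_depths C) = size C.
  exact: (@size_gate_run m _ dstep).
split.
  case=> C [/wf_circuitP[C_gt0 topC] outC depC sizeC].
  exists C, (nth 0 (circuit_values C)), (nth 0%N (gate_depths C)); split=> //.
    split=> //.
    - by move=> i ltiC; rewrite {1}(nth_gate_run val_local topC ltiC).
    - move=> i j ltiC jP.
      rewrite [X in (_ < X)%N](nth_gate_run dep_local topC ltiC) /dstep.
      by rewrite (big_rem _ jP) /= leq_maxl.
    - move=> i ltiC; apply: leq_trans depC; rewrite /circuit_depth.
      have iP : nth 0%N (gate_depths C) i \in gate_depths C by rewrite mem_nth ?szD.
      by rewrite (big_rem _ iP) /= leq_maxl.
  by rewrite -outC /circuit_output -nth_last szV.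
case=> C [V [D [C_gt0 [topC valC depC bndC] outC sizeC]]].
exists C; split=> //; first exact/wf_circuitP.
  rewrite -outC /circuit_output -nth_last szV.
  have: ((size C).-1 < size C)%N by rewrite prednK.
  elim/ltn_ind: (size C).-1 => i IH ltiC.
  rewrite (nth_gate_run val_local topC ltiC) valC //.
  apply: (@eq_gval m) => j jP; have ltji := topC _ _ ltiC jP.
  by apply: IH => //; apply: ltn_trans ltji ltiC.
have leD i : (i < size C)%N -> (nth 0 (gate_depths C) i <= D i)%N.
  elim/ltn_ind: i => i IH ltiC.
  rewrite [X in (X <= _)%N](nth_gate_run dep_local topC ltiC) /dstep.
  rewrite big_seq; elim/big_ind: _ => // [x y lex ley|j jP]; first by rewrite geq_max lex.
  have ltji := topC _ _ ltiC jP; apply: leq_ltn_trans (depC _ _ ltiC jP).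
  by apply: IH => //; apply: ltn_trans ltji ltiC.
rewrite /circuit_depth big_seq; elim/big_ind: _ => // [x y lex ley|e].
  by rewrite geq_max lex.
case/(nthP 0%N) => i; rewrite szD => ltiC <-.
exact: leq_trans (leD _ ltiC) (bndC _ ltiC).
Qed.

Lemma computable_weaken m Delta Delta' s s' (p : {mpoly F[m]}) :
  (Delta <= Delta')%N -> (s <= s')%N ->
  computable Delta s p -> computable Delta' s' p.
Proof.
by move=> leD les [C [wfC outC depC sizeC]]; exists C; split=> //;
  [apply: leq_trans leD | apply: leq_trans les].
Qed.

Lemma computable_gate m (u : gate F m) :
  children u = [::] -> computable 0 0 (gval (fun=> 0) u).
Proof.
move=> u0; apply/computableP; exists [:: u], (fun=> gval (fun=> 0) u), (fun=> 0%N).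
split=> //; last by rewrite /circuit_size /= u0.
split=> [[|i] j|[|i] _|[|i] j|] //=; rewrite ?u0 //.
by apply: eq_gval; rewrite u0.
Qed.

Lemma computableC m c : computable 0 0 (c%:MP : {mpoly F[m]}).
Proof. exact: (computable_gate (u := Const c)). Qed.

Lemma computableX m i : computable 0 0 ('X_i : {mpoly F[m]}).
Proof. exact: (computable_gate (u := Input i)). Qed.

Definition shift_gate m o (u : gate F m) : gate F m :=
  match u with
  | SumGate l => SumGate (map (addn o) l)
  | ProdGate l => ProdGate (map (addn o) l)
  | _ => u
  end.

Lemma children_shift m o (u : gate F m) :
  children (shift_gate o u) = map (addn o) (children u).
Proof. by case: u. Qed.

Lemma gval_shift m o V (u : gate F m) :
  gval V (shift_gate o u) = gval (fun j => V (o + j)%N) u.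
Proof. by case: u => //= l; rewrite big_map. Qed.

Lemma annotated_cat m (C1 C2 : circuit F m) V1 V2 D1 D2 Delta :
  annotated C1 V1 D1 Delta -> annotated C2 V2 D2 Delta ->
  annotated (C1 ++ map (shift_gate (size C1)) C2)
    (fun j => if (j < size C1)%N then V1 j else V2 (j - size C1)%N)
    (fun j => if (j < size C1)%N then D1 j else D2 (j - size C1)%N) Delta.
Proof.
move=> [top1 val1 dep1 bnd1] [top2 val2 dep2 bnd2].
have nthC i : (i < size (C1 ++ map (shift_gate (size C1)) C2))%N ->
   ~~ (i < size C1)%N -> (i - size C1 < size C2)%N /\
   nth (gate0 m) (C1 ++ map (shift_gate (size C1)) C2) i =
     shift_gate (size C1) (nth (gate0 m) C2 (i - size C1)).
  move=> lti; rewrite -leqNgt => gei.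
  have lti2 : (i - size C1 < size C2)%N.
    by rewrite ltn_subLR //; move: lti; rewrite size_cat size_map.
  by split=> //; rewrite nth_cat ltnNge gei /= (nth_map (gate0 m)).
split.
- move=> i j lti; case: (boolP (i < size C1)%N) => [lti1|gei1].
    by rewrite nth_cat lti1; apply: top1.
  have [lti2 ->] := nthC _ lti gei1; rewrite children_shift => /mapP[k /(top2 _ _ lti2) ltk ->].
  by rewrite -ltn_subRL.
- move=> i lti; case: (boolP (i < size C1)%N) => [lti1|gei1].
    rewrite nth_cat lti1 val1 //; apply: eq_gval => j /(top1 _ _ lti1) ltji.
    by rewrite (ltn_trans ltji lti1).
  have [lti2 ->] := nthC _ lti gei1; rewrite gval_shift val2 //; apply: eq_gval => j _.
  by rewrite ltnNge leq_addr addKn.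
- move=> i j lti; case: (boolP (i < size C1)%N) => [lti1|gei1].
    rewrite nth_cat lti1 => jP; have ltji := top1 _ _ lti1 jP.
    by rewrite (ltn_trans ltji lti1); apply: dep1.
  have [lti2 ->] := nthC _ lti gei1; rewrite children_shift => /mapP[k kP ->].
  by rewrite /= [(size C1 + k < size C1)%N]ltnNge leq_addr addKn; apply: dep2.
- move=> i lti; case: (boolP (i < size C1)%N) => [/bnd1 //|gei1].
  by have [/bnd2] := nthC _ lti gei1.
Qed.

Lemma circuit_size_cat m (C1 C2 : circuit F m) :
  circuit_size (C1 ++ C2) = (circuit_size C1 + circuit_size C2)%N.
Proof. by rewrite /circuit_size map_cat sumn_cat. Qed.

Lemma circuit_size_shift m o (C : circuit F m) :
  circuit_size (map (shift_gate o) C) = circuit_size C.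
Proof.
rewrite /circuit_size -map_comp; congr sumn; apply: eq_map => u /=.
by rewrite children_shift size_map.
Qed.

Lemma computable_family m Delta s (L : seq {mpoly F[m]}) :
  (forall p, p \in L -> computable Delta s p) ->
  exists C V D, [/\ annotated C V D Delta, (circuit_size C <= size L * s)%N
    & forall p, p \in L -> exists2 j, (j < size C)%N & V j = p].
Proof.
elim: L => [|p L IH] compL.
  by exists [::], (fun=> 0), (fun=> 0%N); split=> //; split.
have [|C2 [V2 [D2 [annC2 size2 memL]]]] := IH.
  by move=> q qL; apply: compL; rewrite inE qL orbT.
have /computableP[C1 [V1 [D1 [C1_gt0 annC1 outC size1]]]] := compL p (mem_head _ _).
exists (C1 ++ map (shift_gate (size C1)) C2).
exists (fun j => if (j < size C1)%N then V1 j else V2 (j - size C1)%N).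
exists (fun j => if (j < size C1)%N then D1 j else D2 (j - size C1)%N).
split; first exact: annotated_cat.
  by rewrite circuit_size_cat circuit_size_shift mulSn leq_add.
move=> q; rewrite inE => /predU1P[->|/memL[j ltj <-]].
  exists (size C1).-1; last by rewrite ltn_predL C1_gt0.
  by rewrite size_cat -ltnS prednK // ltnS leq_addr.
exists (size C1 + j)%N; first by rewrite size_cat size_map ltn_add2l.
by rewrite ltnNge leq_addr addKn.
Qed.

Lemma computable_comp m m' (f : {mpoly F[m]}) (q : 'I_m -> {mpoly F[m']})
    Delta s Delta' s' :
  computable Delta s f -> (forall i, computable Delta' s' (q i)) ->
  computable (Delta' + Delta) (s.+1 * s'.+1) (mmap (@mpolyC m' F) q f).
Proof.
move=> /computableP[C [V [D [C_gt0 [topC valC depC bndC] outC sizeC]]]] compq.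
have ltlast : ((size C).-1 < size C)%N by rewrite prednK.
pose isIn j := if nth (gate0 m) C j is Input i then Some (q i) else None.
case outI: (isIn (size C).-1) => [p|].
  rewrite -outC valC //; move: outI; rewrite /isIn.
  case: (nth _ _ _) => //= i _; rewrite mmapX mmap1U.
  by apply: computable_weaken (compq i); rewrite ?leq_addr // mulSn leqW ?leq_addr.
pose L := pmap isIn (flatten [seq children u | u <- C]).
have [|B [W [E [[topB valB depB bndB] sizeB memL]]]] := @computable_family _ Delta' s' L.
  move=> p; rewrite mem_pmap => /mapP[j _]; rewrite /isIn.
  by case: (nth _ _ _) => // i [->].
have sizeL : (size L <= circuit_size C)%N.
  rewrite size_pmap; apply: leq_trans (count_size _ _) _.
  by rewrite size_flatten /shape -map_comp.
pose ref j := if isIn j is Some p then find (fun b => W b == p) (iota 0 (size B))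
              else (size B + j)%N.
pose tr (u : gate F m) : gate F m' :=
  match u with
  | Input _ => Const 0
  | Const c => Const c
  | SumGate l => SumGate (map ref l)
  | ProdGate l => ProdGate (map ref l)
  end.
have chtr u : children (tr u) = map ref (children u) by case: u.
pose V' j := if (j < size B)%N then W j else
  if isIn (j - size B)%N is Some _ then 0 else mmap (@mpolyC m' F) q (V (j - size B)%N).
pose D' j := if (j < size B)%N then E j else (Delta' + D (j - size B))%N.
have refP i j : (i < size C)%N -> j \in children (nth (gate0 m) C i) ->
    [/\ (ref j < size B + i)%N, V' (ref j) = mmap (@mpolyC m' F) q (V j)
      & (D' (ref j) < Delta' + D i)%N].
  move=> lti jP; have ltji := topC _ _ lti jP; have ltDji := depC _ _ lti jP.
  have ltj : (j < size C)%N := ltn_trans ltji lti.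
  rewrite /ref; case inj: (isIn j) => [p|]; last first.
    rewrite ltn_add2l ltji /V' /D' !ltnNge !leq_addr !addKn /= inj -ltnNge.
    by rewrite ltn_add2l.
  have pL : p \in L.
    rewrite mem_pmap -inj; apply: map_f; apply/flattenP.
    exists (children (nth (gate0 m) C i)) => //; apply/(nthP [::]).
    by exists i; rewrite ?size_map // (nth_map (gate0 m)).
  have hasp : has (fun b => W b == p) (iota 0 (size B)).
    have [b ltb Wb] := memL _ pL; apply/hasP; exists b; last exact/eqP.
    by rewrite mem_iota.
  set b := find _ _; have ltb : (b < size B)%N.
    by have := hasp; rewrite has_find size_iota.
  have Wb : W b = p.
    by have /eqP := nth_find 0%N hasp; rewrite -/b nth_iota.
  rewrite /V' /D' ltb Wb; split.
  - exact: leq_trans ltb (leq_addr _ _).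
  - rewrite valC //; move: inj; rewrite /isIn.
    by case: (nth _ _ _) => //= l [<-]; rewrite mmapX mmap1U.
  - apply: leq_ltn_trans (bndB _ ltb) _.
    by rewrite -[X in (X < _)%N]addn0 ltn_add2l; case: (D i) ltDji.
pose C' := B ++ map tr C.
have nthC' i : (i < size C')%N -> ~~ (i < size B)%N ->
    (i - size B < size C)%N /\ nth (gate0 m') C' i = tr (nth (gate0 m) C (i - size B)).
  move=> lti; rewrite -leqNgt => gei.
  have lti2 : (i - size B < size C)%N.
    by rewrite ltn_subLR //; move: lti; rewrite size_cat size_map.
  by split=> //; rewrite nth_cat ltnNge gei /= (nth_map (gate0 m)).
have lastC' : (size C').-1 = (size B + (size C).-1)%N.
  by rewrite size_cat size_map -[in LHS](prednK C_gt0) addnS.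
apply/computableP; exists C', V', D'; split.
- by rewrite size_cat size_map ltn_addl.
- split.
  + move=> i j lti; case: (boolP (i < size B)%N) => [ltiB|geiB].
      by rewrite nth_cat ltiB; apply: topB.
    have [lti2 ->] := nthC' _ lti geiB; rewrite chtr => /mapP[k kP ->].
    by have [] := refP _ _ lti2 kP; rewrite subnKC // leqNgt.
  + move=> i lti; case: (boolP (i < size B)%N) => [ltiB|geiB].
      rewrite nth_cat ltiB /V' ltiB valB //; apply: eq_gval => j /(topB _ _ ltiB) ltji.
      by rewrite (ltn_trans ltji ltiB).
    have [lti2 ->] := nthC' _ lti geiB; rewrite {1}/V' (negPf geiB).
    have refi := refP _ _ lti2; have := valC _ lti2; move: refi; rewrite /isIn.
    case: (nth _ _ _) => [k|c|l|l] /= refi valV; first by rewrite mpolyC0.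
    - by rewrite valV mmapC.
    - by rewrite valV rmorph_sum big_map; apply: eq_big_seq => j /refi[].
    - by rewrite valV rmorph_prod big_map; apply: eq_big_seq => j /refi[].
  + move=> i j lti; case: (boolP (i < size B)%N) => [ltiB|geiB].
      rewrite nth_cat ltiB => jP; have ltji := topB _ _ ltiB jP.
      by rewrite /D' ltiB (ltn_trans ltji ltiB); apply: depB.
    have [lti2 ->] := nthC' _ lti geiB; rewrite chtr => /mapP[k kP ->].
    by have [_ _] := refP _ _ lti2 kP; rewrite [D' i]/D' (negPf geiB).
  + move=> i lti; rewrite /D'; case: (boolP (i < size B)%N) => [ltiB|geiB].
      exact: leq_trans (bndB _ ltiB) (leq_addr _ _).
    have [lti2 _] := nthC' _ lti geiB; rewrite leq_add2l; exact: bndC.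
- by rewrite lastC' /V' ltnNge leq_addr addKn /= outI outC.
- have -> : circuit_size C' = (circuit_size B + circuit_size C)%N.
    rewrite circuit_size_cat; congr (_ + _)%N; rewrite /circuit_size -map_comp.
    by congr sumn; apply: eq_map => u /=; rewrite chtr size_map.
  rewrite mulnS addSn mulSn; apply: leqW; rewrite addnC.
  apply: leq_add => //; apply: leq_trans sizeB _; apply: leq_trans (leq_addl _ _).
  by rewrite leq_mul2r (leq_trans sizeL sizeC) orbT.
Qed.

Lemma computable_big_gate m (b : bool) :
  computable 1 m (if b then \sum_(i < m) 'X_i else \prod_(i < m) 'X_i : {mpoly F[m]}).
Proof.
pose top := (if b then SumGate else ProdGate) (iota 0 m) : gate F m.
have chtop : children top = iota 0 m by rewrite /top; case: (b).
pose C : circuit F m := rcons [seq Input i | i <- enum 'I_m] top.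
have szI : size [seq @Input F m i | i <- enum 'I_m] = m by rewrite size_map size_enum_ord.
have szC : size C = m.+1 by rewrite size_rcons szI.
pose v := if b then \sum_(i < m) 'X_i else \prod_(i < m) 'X_i : {mpoly F[m]}.
pose V j : {mpoly F[m]} := if insub j is Some i then 'X_i else v.
have nthI i (ltim : (i < m)%N) : nth (gate0 m) C i = Input (Ordinal ltim).
  rewrite nth_rcons szI ltim (nth_map (Ordinal ltim)) ?size_enum_ord //.
  by congr Input; apply: val_inj; rewrite /= nth_enum_ord.
have nthT : nth (gate0 m) C m = top by rewrite nth_rcons szI ltnn eqxx.
have Vm : V m = v by rewrite /V insubF ?ltnn.
apply/computableP; exists C, V, (fun j => (m <= j)%N : nat); split.
- by rewrite szC.
- split=> [i j|i|i j|i _]; last by case: (m <= i)%N.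
  + rewrite szC ltnS leq_eqVlt => /predU1P[->|ltim]; last by rewrite (nthI _ ltim).
    by rewrite nthT chtop mem_iota.
  + rewrite szC ltnS leq_eqVlt => /predU1P[->|ltim]; last first.
      by rewrite (nthI _ ltim) /V insubT.
    have -> : nth (gate0 m) C m = (if b then SumGate else ProdGate) (index_iota 0 m).
      by rewrite nthT /index_iota subn0.
    rewrite Vm /v; case: (b) => /=; rewrite big_mkord;
      by apply: eq_bigr => l _; rewrite /V valK.
  + rewrite szC ltnS leq_eqVlt => /predU1P[->|ltim]; last by rewrite (nthI _ ltim).
    by rewrite nthT chtop mem_iota add0n leq0n /= leqnn [(m <= j)%N]leqNgt => ->.
- by rewrite szC.
- by rewrite /circuit_size map_rcons sumn_rcons chtop size_iota sumnE !big_map big1.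
Qed.

Lemma computable_big m (b : bool) Delta s (L : seq {mpoly F[m]}) :
  (forall p, p \in L -> computable Delta s p) ->
  computable Delta.+1 ((size L).+1 * s.+1)
    (if b then \sum_(p <- L) p else \prod_(p <- L) p).
Proof.
move=> compL; have := computable_comp (q := tnth (in_tuple L)) (computable_big_gate (size L) b).
move=> /(_ Delta s) compb; rewrite -addn1.
have -> : (if b then \sum_(p <- L) p else \prod_(p <- L) p) =
  mmap (@mpolyC m F) (tnth (in_tuple L))
    (if b then \sum_(i < size L) 'X_i else \prod_(i < size L) 'X_i).
  case: (b); rewrite ?rmorph_sum ?rmorph_prod big_tnth /=;
    by apply: eq_bigr => i _; rewrite mmapX mmap1U.
by apply: compb => i; apply: compL; rewrite mem_tnth.
Qed.

Lemma computable_sum m Delta s (L : seq {mpoly F[m]}) :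
  (forall p, p \in L -> computable Delta s p) ->
  computable Delta.+1 ((size L).+1 * s.+1) (\sum_(p <- L) p).
Proof. exact: (@computable_big _ true). Qed.

Lemma computable_prod m Delta s (L : seq {mpoly F[m]}) :
  (forall p, p \in L -> computable Delta s p) ->
  computable Delta.+1 ((size L).+1 * s.+1) (\prod_(p <- L) p).
Proof. exact: (@computable_big _ false). Qed.

Fixpoint monomials_upto N r : seq 'X_{1..N} :=
  if r is r'.+1 then
    [seq (m + U_(i))%MM | m <- monomials_upto N r', i <- enum 'I_N] ++ monomials_upto N r'
  else [:: 0%MM].

Lemma size_monomials_upto N r : size (monomials_upto N r) = (N.+1 ^ r)%N.
Proof.
elim: r => //= r IH; rewrite size_cat size_allpairs size_enum_ord IH.
by rewrite expnS mulSn mulnC addnC.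
Qed.

Lemma mem_monomials_upto N r (m : 'X_{1..N}) :
  (mdeg m <= r)%N -> m \in monomials_upto N r.
Proof.
elim: r m => [|r IH] m; first by rewrite leqn0 mdeg_eq0 inE.
move=> lem /=; rewrite mem_cat; have [/IH ->|gtm] := leqP (mdeg m) r; first by rewrite orbT.
have m_neq0 : m != 0%MM by rewrite -mdeg_eq0 -lt0n (leq_ltn_trans _ gtm).
have [i mi] : exists i, m i != 0%N.
  apply/existsP; rewrite -negb_forall; apply: contraNN m_neq0 => /forallP m0.
  by apply/eqP/mnmP => i; rewrite mnm0E; apply/eqP/m0.
have lei : (U_(i) <= m)%MM by rewrite lep1mP.
have defm : m = ((m - U_(i)) + U_(i))%MM by rewrite submK.
apply/orP; left; rewrite defm; apply/allpairsP; exists ((m - U_(i))%MM, i) => /=.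
split=> //; last by rewrite mem_enum.
by apply: IH; move: lem; rewrite {1}defm mdegD mdeg1 addn1.
Qed.

Lemma size_msupp_le N r (P : {mpoly F[N]}) :
  (msize P <= r.+1)%N -> (size (msupp P) <= N.+1 ^ r)%N.
Proof.
move=> leP; rewrite -size_monomials_upto; apply: uniq_leq_size => // m mP.
by apply: mem_monomials_upto; rewrite -ltnS (leq_trans (msize_mdeg_lt mP)).
Qed.

Definition polyval_size N r s := ((N.+1 ^ r).+1 * ((r.+2 * s.+1).+1))%N.

Lemma computable_polyval m N r (P : {mpoly F[N]}) (h : 'I_N -> {mpoly F[m]}) Delta s :
  (msize P <= r.+1)%N -> (forall i, computable Delta s (h i)) ->
  computable Delta.+2 (polyval_size N r s) (mmap (@mpolyC m F) h P).
Proof.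
move=> leP comph; rewrite /mmap.
have monP M : mdeg M = (\sum_(i < N) M i)%N by rewrite mdegE.
pose fac (M : 'X_{1..N}) := (P@_M)%:MP :: flatten [seq nseq (M i) (h i) | i <- enum 'I_N].
have facE M : (P@_M)%:MP * mmap1 h M = \prod_(p <- fac M) p.
  rewrite /fac big_cons big_flatten big_map big_enum /=; congr (_ * _); rewrite /mmap1.
  by apply: eq_bigr => i _; rewrite big_nseq iter_mulr mulr1.
have sizefac M : size (fac M) = (mdeg M).+1.
  rewrite /= size_flatten /shape -map_comp sumnE big_map big_enum monP /=.
  by congr _.+1; apply: eq_bigr => i _; rewrite /= size_nseq.
have -> : \sum_(M <- msupp P) (P@_M)%:MP * mmap1 h M =
    \sum_(p <- [seq \prod_(p <- fac M) p | M <- msupp P]) p.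
  by rewrite [RHS]big_map; apply: eq_bigr => M _; rewrite facE.
apply: computable_weaken (leqnn _) _ (computable_sum (Delta := Delta.+1) (s := r.+2 * s.+1) _).
  rewrite /polyval_size leq_mul2r ltnS size_map; apply/orP; right; exact: size_msupp_le.
move=> _ /mapP[M MP ->].
apply: computable_weaken (leqnn _) _ (computable_prod (Delta := Delta) (s := s) _).
  by rewrite leq_mul2r sizefac !ltnS -ltnS (leq_trans (msize_mdeg_lt MP)) ?orbT.
move=> p; rewrite inE => /predU1P[->|/flattenP[t /mapP[i _ ->]]].
  exact: computable_weaken (computableC _ _).
by rewrite mem_nseq => /andP[_ /eqP ->].
Qed.

End Circuits.

(** * Interpolation and algebraic elements *)

Section MmapTheory.

Variables (F : fieldType) (m : nat).

Lemma rmorph_mmap (R S : comNzRingType) (psi : {rmorphism R -> S})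
    (iota : {rmorphism F -> R}) (v : 'I_m -> R) (A : {mpoly F[m]}) :
  psi (mmap iota v A) = mmap (psi \o iota) (psi \o v) A.
Proof.
rewrite /mmap rmorph_sum; apply: eq_bigr => M _; rewrite rmorphM; congr (_ * _).
by rewrite /mmap1 rmorph_prod; apply: eq_bigr => i _; rewrite rmorphXn.
Qed.

Lemma eq_mmap (R : comNzRingType) (iota iota' : F -> R) (v v' : 'I_m -> R)
    (A : {mpoly F[m]}) :
  iota =1 iota' -> v =1 v' -> mmap iota v A = mmap iota' v' A.
Proof.
move=> eqi eqv; rewrite /mmap; apply: eq_bigr => M _; rewrite eqi; congr (_ * _).
exact: mmap1_eq.
Qed.

Lemma mmap_var (A : {mpoly F[m]}) : mmap (@mpolyC m F) (fun i => 'X_i) A = A.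
Proof.
rewrite {2}[A]mpolyE /mmap; apply: eq_bigr => M _.
by rewrite mmap1_id mul_mpolyC.
Qed.

End MmapTheory.

Section CharacteristicZero.

Variable F : fieldType.
Hypothesis F_char0 : [pchar F] =i pred0.

Lemma natr_inj_pchar0 : injective (fun i : nat => i%:R : F).
Proof.
move=> i j; wlog leij : i j / (i <= j)%N => [hw eqij|/= /eqP].
  by case/orP: (leq_total i j) => [/hw/(_ eqij)|/hw/(_ (esym eqij))].
rewrite eq_sym -subr_eq0 -natrB // (proj1 (pcharf0P F)) // subn_eq0 => leji.
by apply/eqP; rewrite eqn_leq leij.
Qed.

Lemma poly_eval_eq0 (p : {poly F}) : (forall x, p.[x] = 0) -> p = 0.
Proof.
move=> p0; apply/eqP/negPn/negP => p_neq0.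
have := @max_poly_roots _ p [seq i%:R | i <- iota 0 (size p)] p_neq0.
rewrite size_map size_iota ltnn map_inj_uniq ?iota_uniq; last exact: natr_inj_pchar0.
suff -> : all (root p) [seq i%:R | i <- iota 0 (size p)] by move=> /(_ isT isT).
by apply/allP => x _; rewrite rootE p0.
Qed.

Lemma mpoly_eval_eq0 n (p : {mpoly F[n]}) : (forall v, p.@[v] = 0) -> p = 0.
Proof.
elim: n p => [|n IH] p p0.
  have := p0 (fun=> 0); rewrite {1}(nvar0_mpolyC p) mevalC => p00.
  by rewrite (nvar0_mpolyC p) p00 mpolyC0.
pose uni : {poly {mpoly F[n]}} := mmap (polyC \o @mpolyC n F)
  (fun i => if unlift ord_max i is Some j then ('X_j)%:P else 'X) p.
pose multi : {rmorphism {poly {mpoly F[n]}} -> {mpoly F[n.+1]}} :=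
  horner_eval 'X_ord_max \o map_poly
    (mmap (@mpolyC n.+1 F) (fun j : 'I_n => 'X_(lift ord_max j))).
have multiK : multi uni = p.
  rewrite /uni rmorph_mmap -[RHS]mmap_var; apply: eq_mmap => [c|i] /=.
    by rewrite map_polyC /horner_eval hornerC /= mmapC.
  case: unliftP => [j ->|->] /=; last by rewrite map_polyX /horner_eval hornerX.
  by rewrite map_polyC /horner_eval hornerC /= mmapX mmap1U.
suff uni0 : uni = 0 by rewrite -multiK uni0 rmorph0.
apply/polyP => c; rewrite coef0; apply: IH => v.
suff: map_poly (meval v) uni = 0 by move/polyP/(_ c); rewrite coef_map coef0.
apply: poly_eval_eq0 => x.
pose ev : {rmorphism {poly {mpoly F[n]}} -> F} := horner_eval x \o map_poly (meval v).
have := p0 (fun i => if unlift ord_max i is Some j then v j else x).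
move<-; rewrite -[LHS]/(ev uni) /uni rmorph_mmap; apply: eq_mmap => [b|i] /=.
  by rewrite map_polyC /horner_eval hornerC /= mevalC.
case: unliftP => [j _|_] /=; last by rewrite map_polyX /horner_eval hornerX.
by rewrite map_polyC /horner_eval hornerC /= mevalXU.
Qed.

Lemma mpoly_neq0_eval n (p : {mpoly F[n]}) : p != 0 -> exists v, p.@[v] != 0.
Proof.
move=> p_neq0; apply: NNPP => np; case/eqP: p_neq0.
by apply: mpoly_eval_eq0 => v; apply/eqP/negPn/negP => pv; apply: np; exists v.
Qed.

(* On every line through the origin [p] restricts to a univariate polynomial
   that is algebraic over [F], hence constant. *)
Lemma algebraic_mpolyC n (P : {poly F}) (p : {mpoly F[n]}) :
  P != 0 -> (map_poly (@mpolyC n F) P).[p] = 0 -> p = (p.@[fun=> 0])%:MP.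
Proof.
move=> P_neq0 Pp0; apply/eqP; rewrite -subr_eq0; apply/eqP/mpoly_eval_eq0 => v.
rewrite mevalB mevalC; apply/eqP; rewrite subr_eq0; apply/eqP.
pose line : {rmorphism {mpoly F[n]} -> {poly F}} := mmap polyC (fun i => (v i)%:P * 'X).
have lineE x : (line p).[x] = p.@[fun i => v i * x].
  rewrite -[LHS]/(horner_eval x _) rmorph_mmap /meval; apply: eq_mmap => [c|i] /=.
    by rewrite /horner_eval hornerC.
  by rewrite /horner_eval !hornerE.
have : P \Po line p = 0.
  rewrite -[LHS]/((map_poly polyC P).[line p]) -[0](rmorph0 line) -Pp0.
  rewrite -horner_map -map_poly_comp; congr (_.[_]); apply: eq_map_poly => c /=.
  by rewrite mmapC.
case: (ltnP 1 (size (line p))) => [szl /eqP|/size1_polyC defl _].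
  by rewrite comp_poly_eq0 // (negPf P_neq0).
have := lineE 1; have := lineE 0; rewrite defl !hornerC => -> eq01.
transitivity (p.@[fun i => v i * 1]); first by apply: meval_eq => i; rewrite mulr1.
by rewrite -eq01; apply: meval_eq => i; rewrite mulr0.
Qed.

Lemma interpolation N : exists (tau : 'I_N -> F) (lam : nat -> 'I_N -> F),
  forall (R : comNzRingType) (iota : {rmorphism F -> R}) (p : {poly R}) c,
    (size p <= N)%N -> p`_c = \sum_l iota (lam c l) * p.[iota (tau l)].
Proof.
pose tau (l : 'I_N) : F := l%:R.
pose V := Vandermonde N (\row_l tau l).
have V_unit : V \in unitmx.
  rewrite unitmxE det_Vandermonde unitfE; apply/prodf_neq0 => i _.
  apply/prodf_neq0 => j ltij; rewrite !mxE subr_eq0.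
  by apply: contraTneq ltij => /natr_inj_pchar0 ->; rewrite ltnn.
exists tau, (fun c l => if insub c is Some c' then invmx V l c' else 0) => R iota p c szp.
case: insubP => [c' _ defc'|]; last first.
  rewrite -leqNgt => leNc; rewrite nth_default ?(leq_trans szp) // big1 // => l _.
  by rewrite rmorph0 mul0r.
under eq_bigr => l _ do rewrite (horner_coef_wide _ szp) mulr_sumr.
rewrite exchange_big /= (bigD1 c') //= [X in _ + X]big1 ?addr0 => [|e ne_ec].
  under eq_bigr => l _ do rewrite mulrCA -rmorphXn -rmorphM.
  rewrite -mulr_sumr -rmorph_sum defc' [X in iota X](_ : _ = 1) ?rmorph1 ?mulr1 //.
  have := congr1 (fun M : 'M_N => M c' c') (mulmxV V_unit); rewrite !mxE eqxx /= => eq1.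
  by apply: etrans (eq1 : _ = 1); apply: eq_bigr => l _; rewrite !mxE mulrC defc'.
under eq_bigr => l _ do rewrite mulrCA -rmorphXn -rmorphM.
rewrite -mulr_sumr -rmorph_sum [X in iota X](_ : _ = 0) ?rmorph0 ?mulr0 //.
have := congr1 (fun M : 'M_N => M e c') (mulmxV V_unit); rewrite !mxE (negPf ne_ec) => eq0.
by apply: etrans (eq0 : _ = 0); apply: eq_bigr => l _; rewrite !mxE mulrC.
Qed.

End CharacteristicZero.

(** * Filtrations and the implicit function recursion *)

Definition coef_filt (R : comNzRingType) (M : nat -> R -> Prop) r (p : {poly R}) :=
  forall c, M r p`_c.
Definition size_filt (R : comNzRingType) r (p : {poly R}) := (size p <= r.+1)%N.
Definition msize_filt (F : fieldType) n r (p : {mpoly F[n]}) := (msize p <= r.+1)%N.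

Record filtration (R : comNzRingType) (M : nat -> R -> Prop) : Prop := Filtration {
  filt0 : M 0%N 0;
  filt1 : M 0%N 1;
  filtN : forall r x, M r x -> M r (- x);
  filtD : forall r x y, M r x -> M r y -> M r (x + y);
  filt_leq : forall r s x, (r <= s)%N -> M r x -> M s x;
  filtM : forall r s x y, M r x -> M s y -> M (r + s)%N (x * y) }.

Section Filtration.

Variables (R : comNzRingType) (M : nat -> R -> Prop).
Hypothesis filtM_ : filtration M.
Let M0 := filt0 filtM_.
Let M1 := filt1 filtM_.
Let MN := filtN filtM_.
Let MD := filtD filtM_.
Let Mle := filt_leq filtM_.
Let MM := filtM filtM_.

Lemma filt_zero r : M r 0.
Proof. exact: Mle (leq0n r) M0. Qed.

Lemma filt_sum (I : Type) (s : seq I) (P : pred I) (E : I -> R) r :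
  (forall i, P i -> M r (E i)) -> M r (\sum_(i <- s | P i) E i).
Proof.
by move=> ME; elim/big_ind: _ => [|x y|] //; [exact: filt_zero | exact: MD].
Qed.

Lemma filt_exp e x n : M e x -> M (n * e)%N (x ^+ n).
Proof.
by move=> Mx; elim: n => [|n IH]; rewrite ?expr0 ?exprS ?mulSn //; apply: MM.
Qed.

Lemma filt_prod (I : Type) (s : seq I) (w : I -> nat) (E : I -> R) :
  (forall i, M (w i) (E i)) -> M (\sum_(i <- s) w i)%N (\prod_(i <- s) E i).
Proof. by move=> ME; elim/big_rec2: _ => // i r x _ Mx; apply: MM. Qed.

Lemma filt_mmap (F : fieldType) m (iota : {rmorphism F -> R}) (v : 'I_m -> R)
    (A : {mpoly F[m]}) e r :
  (forall c, M 0%N (iota c)) -> (forall i, M e (v i)) ->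
  (msize A <= r.+1)%N -> M (r * e)%N (mmap iota v A).
Proof.
move=> Mi Mv szA; rewrite /mmap big_seq; apply: filt_sum => N NA.
rewrite -[(r * e)%N]add0n; apply: MM => //.
apply: (@Mle (\sum_(i < m) N i * e)%N).
  rewrite -big_distrl -mdegE leq_mul2r -ltnS.
  by rewrite (leq_trans (msize_mdeg_lt NA)) ?orbT.
by apply: filt_prod => i; apply: filt_exp.
Qed.

Lemma filt_scale D : filtration (fun r => M (r * D)%N).
Proof.
split=> //.
- by move=> r x; apply: MN.
- by move=> r x y; apply: MD.
- by move=> r s x ler; apply: Mle; rewrite leq_mul2r ler orbT.
- by move=> r s x y Mx My; rewrite mulnDl; apply: MM.
Qed.

Lemma filt_coef : filtration (coef_filt M).
Proof.
split.
- by move=> c; rewrite coef0.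
- by move=> c; rewrite coef1; case: (c == 0)%N.
- by move=> r p Mp c; rewrite coefN; apply: MN.
- by move=> r p q Mp Mq c; rewrite coefD; apply: MD.
- by move=> r s p ler Mp c; apply: Mle (Mp c).
- by move=> r s p q Mp Mq c; rewrite coefM; apply: filt_sum => i _; apply: MM.
Qed.

Lemma filt_coef_exp w (q : {poly R}) a c :
  (forall j, (j <= c)%N -> M (w * j + 1)%N q`_j) -> M (w * c + a)%N (q ^+ a)`_c.
Proof.
move=> Mq; suff: forall c', (c' <= c)%N -> M (w * c' + a)%N (q ^+ a)`_c' by apply.
elim: a => [|a IH] c' lec'.
  rewrite expr0 coef1; case: (c' == 0)%N; [exact: Mle (leq0n _) M1 | exact: filt_zero].
rewrite exprS coefM; apply: filt_sum => -[j /=]; rewrite ltnS => lej _.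
have -> : (w * c' + a.+1 = (w * j + 1) + (w * (c' - j) + a))%N.
  by rewrite addnACA -mulnDr subnKC.
by apply: MM; [apply: Mq; apply: leq_trans lec' | apply: IH; rewrite (leq_trans (leq_subr _ _))].
Qed.

Lemma filt_coef_horner N (G : {poly {poly R}}) (q : {poly R}) b :
  (forall a c, (a + c <= N)%N -> M 1%N G`_a`_c) ->
  (forall i, (i < N)%N -> M 1%N q`_i) ->
  (b <= N)%N -> M N.+1 (G.['X * q])`_b.
Proof.
move=> MG Mq leb; rewrite horner_coef coef_sum; apply: filt_sum => -[a /= _] _.
rewrite exprMn mulrCA coefXnM; case: ltnP => lea; first exact: filt_zero.
rewrite coefM; apply: filt_sum => -[c /=]; rewrite ltnS => lec _.
apply: (@Mle (1 + (0 * (b - a - c) + a))%N); first by lia.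
apply: MM; first by apply: MG; lia.
case: a lea lec => [|a] lea lec.
  by rewrite expr0 coef1; case: (_ == _); [exact: Mle (leq0n _) M1 | exact: filt_zero].
by apply: filt_coef_exp => j lej; apply: Mq; lia.
Qed.

(* The weight [2 i + 1] makes the recursion for the coefficients of the implicit
   function close up: a coefficient of [G] of bidegree [(b, a)] costs 1, and
   [a + 2 b >= 2] for every term other than [G`_1`_0 * q`_i]. *)
Lemma implicit_function_filt N (G : {poly {poly R}}) (q : {poly R}) :
  (forall a b, (a + b <= N)%N -> M 1%N G`_a`_b) ->
  (forall x, M 0%N ((G`_1`_0 - 1) * x)) ->
  (forall i, (i < N)%N -> M i.*2.+1 (G.['X * q])`_i.+1) ->
  forall i, (i < N)%N -> M i.*2.+1 q`_i.
Proof.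
move=> MG MG1 MGq; elim/ltn_ind => i IH ltiN.
pose n := (size G).+2.
have := MGq i ltiN; rewrite (@horner_coef_wide _ n) ?leqW // coef_sum.
rewrite /n big_ord_recl big_ord_recl /= !expr0 mulr1 expr1.
set rest := \sum_(_ < _) _.
have -> : (G`_1 * ('X * q))`_i.+1 = q`_i + ((G`_1`_0 - 1) * q`_i
    + \sum_(b < i) G`_1`_b.+1 * q`_(i - b.+1)).
  rewrite mulrCA coefXM /= coefM big_ord_recl subn0 mulrBl mul1r /bump /=.
  rewrite addrA addrCA subrr addr0; congr (_ + _).
set E := (G`_1`_0 - 1) * q`_i + _.
have ME : M i.*2.+1 (G`_0`_i.+1 + (E + rest)).
  apply: MD; first by apply: (Mle _ (MG 0%N i.+1 _)).
  apply: MD.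
    apply: MD; first exact: Mle (leq0n _) (MG1 _).
    apply: filt_sum => -[b ltb] _ /=.
    apply: (@Mle (1 + (i - b.+1).*2.+1)%N); first by lia.
    by apply: MM; [apply: MG | apply: IH]; lia.
  apply: filt_sum => -[a lta] _ /=; rewrite /bump /= !add1n.
  rewrite exprMn mulrCA coefXnM; case: ltnP => lea; first exact: filt_zero.
  rewrite coefM; apply: filt_sum => -[b /=]; rewrite ltnS => leb _.
  apply: (@Mle (1 + ((i.+1 - a.+2 - b).*2 + a.+2))%N); first by lia.
  apply: MM; first by apply: MG; lia.
  rewrite -mul2n; apply: filt_coef_exp => j lej; rewrite mul2n addn1.
  by apply: IH; lia.
move=> Mall; have -> : q`_i = G`_0`_i.+1 + (q`_i + E + rest) - (G`_0`_i.+1 + (E + rest)).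
  by rewrite -[q`_i + E + rest]addrA [_ + (q`_i + _)]addrCA addrK.
by apply: MD => //; apply: MN.
Qed.

End Filtration.

Lemma filt_size (R : comNzRingType) :
  filtration (@size_filt R).
Proof.
rewrite /size_filt; split=> [||r p|r p q szp szq|r s p ler szp|r s p q szp szq].
- by rewrite size_poly0.
- by rewrite size_poly1.
- by rewrite size_polyN.
- by apply: leq_trans (size_polyD _ _) _; rewrite geq_max szp.
- exact: leq_trans szp _.
- by apply: leq_trans (size_polyMleq _ _) _; lia.
Qed.

Lemma msizeM_leq (F : fieldType) n (p q : {mpoly F[n]}) :
  (msize (p * q) <= (msize p + msize q).-1)%N.
Proof.
have [->|p0] := eqVneq p 0; first by rewrite mul0r mmeasure0.
have [->|q0] := eqVneq q 0; first by rewrite mulr0 mmeasure0.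
by rewrite msizeM.
Qed.

Lemma filt_msize (F : fieldType) n :
  filtration (@msize_filt F n).
Proof.
rewrite /msize_filt; split=> [||r p|r p q szp szq|r s p ler szp|r s p q szp szq].
- by rewrite mmeasure0.
- by rewrite mmeasure1.
- by rewrite mmeasureN.
- by apply: leq_trans (mmeasureD_le _ _ _) _; rewrite geq_max szp.
- exact: leq_trans szp _.
- by apply: leq_trans (msizeM_leq _ _) _; lia.
Qed.

Lemma size_filtC (R : comNzRingType) (c : R) r : size_filt r c%:P.
Proof. by apply: leq_trans (size_polyC_leq1 _) _. Qed.

Lemma size_filtX (R : comNzRingType) r : (0 < r)%N -> size_filt r ('X : {poly R}).
Proof. by move=> r_gt0; rewrite /size_filt size_polyX. Qed.

Lemma msize_filtC (F : fieldType) n c r : msize_filt r (c%:MP : {mpoly F[n]}).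
Proof. by rewrite /msize_filt msizeC; case: eqP. Qed.

Lemma msize_filtX (F : fieldType) n i r :
  (0 < r)%N -> msize_filt r ('X_i : {mpoly F[n]}).
Proof. by move=> r_gt0; rewrite /msize_filt msizeX mdeg1. Qed.

Section CoefFilt.

Variables (R : comNzRingType) (M : nat -> R -> Prop).
Hypothesis filtM_ : filtration M.

Lemma coef_filtC c r : M r c -> coef_filt M r c%:P.
Proof. by move=> Mc i; rewrite coefC; case: ifP => // _; apply: filt_zero. Qed.

Lemma coef_filtX r : coef_filt M r 'X.
Proof.
move=> i; rewrite coefX; case: eqP => _; last exact: filt_zero.
exact: (filt_leq filtM_ (leq0n _) (filt1 filtM_)).
Qed.

End CoefFilt.

Definition ideal (R : comNzRingType) (I : R -> Prop) :=
  [/\ I 0, forall x y, I x -> I y -> I (x - y) & forall x y, I x -> I (x * y)].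

Definition polyval_mod (F : fieldType) (R : comNzRingType) (iota : {rmorphism F -> R})
    N (h : 'I_N -> R) (I : R -> Prop) r x :=
  exists2 P : {mpoly F[N]}, (msize P <= r.+1)%N & I (x - mmap iota h P).

Section PolyvalMod.

Variables (F : fieldType) (R : comNzRingType) (iota : {rmorphism F -> R}).
Variables (N : nat) (h : 'I_N -> R) (I : R -> Prop).
Hypothesis idealI : ideal I.

Let I0 : I 0. Proof. by case: idealI. Qed.
Let IB x y : I x -> I y -> I (x - y). Proof. by case: idealI => _ + _; apply. Qed.
Let IM x y : I x -> I (x * y). Proof. by case: idealI => _ _; apply. Qed.
Let IN x : I x -> I (- x). Proof. by rewrite -sub0r; apply: IB. Qed.
Let ID x y : I x -> I y -> I (x + y).
Proof. by move=> Ix /IN Iy; rewrite -[y]opprK; apply: IB. Qed.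

Lemma filt_polyval : filtration (polyval_mod iota h I).
Proof.
split=> [||r x [P szP IP]|r x y [P szP IP] [Q szQ IQ]|r s x ler [P szP IP]
    |r s x y [P szP IP] [Q szQ IQ]].
- by exists 0; rewrite ?mmeasure0 // rmorph0 subr0.
- by exists 1; rewrite ?mmeasure1 // rmorph1 subrr.
- by exists (- P); rewrite ?mmeasureN // rmorphN -opprD; apply: IN.
- exists (P + Q); first by apply: leq_trans (mmeasureD_le _ _ _) _; rewrite geq_max szP.
  by rewrite rmorphD opprD addrACA; apply: ID.
- by exists P => //; apply: leq_trans szP _.
- exists (P * Q); first by apply: leq_trans (msizeM_leq _ _) _; lia.
  rewrite rmorphM /=; set p := mmap _ _ P; set q := mmap _ _ Q.
  have -> : x * y - p * q = (x - p) * y + (y - q) * p.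
    by rewrite !mulrBl addrA [p * y]mulrC subrK [q * p]mulrC.
  by apply: ID; apply: IM.
Qed.

Lemma polyval_gen i : polyval_mod iota h I 1 (h i).
Proof.
by exists 'X_i; [rewrite msizeX mdeg1 | rewrite mmapX mmap1U subrr].
Qed.

Lemma polyval_const c : polyval_mod iota h I 0 (iota c).
Proof. by exists c%:MP; [rewrite msizeC; case: eqP | rewrite mmapC subrr]. Qed.

Lemma polyval_ideal x : I x -> polyval_mod iota h I 0 x.
Proof. by move=> Ix; exists 0; rewrite ?mmeasure0 // rmorph0 subr0. Qed.

End PolyvalMod.

Lemma ideal_zero (R : comNzRingType) : ideal (fun x : R => x = 0).
Proof.
by split=> // [x y -> ->|x y ->]; rewrite ?subrr ?mul0r.
Qed.

Lemma ideal_Xn (R : comNzRingType) k :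
  ideal (fun x : {poly R} => exists y, x = y * 'X^k).
Proof.
split=> [|_ _ [y ->] [z ->]|_ z [y ->]]; first by exists 0; rewrite mul0r.
  by exists (y - z); rewrite mulrBl.
by exists (y * z); rewrite mulrAC.
Qed.

Lemma drop_polyE (R : comNzRingType) (p : {poly R}) : p = 'X * drop_poly 1 p + (p`_0)%:P.
Proof.
apply/polyP => -[|i]; rewrite coefD coefXM coefC /= ?add0r ?addr0 //.
by rewrite coef_drop_poly addn1.
Qed.

(** * Regular roots *)

Section Subst3.

Variables (F : fieldType) (n : nat).
Implicit Types (R S : comNzRingType) (A : {mpoly F[n.+2]}).

Lemma rmorph_subst3 R S (psi : {rmorphism R -> S}) (iota : {rmorphism F -> R})
    t (x : 'I_n -> R) y A :
  psi (subst3 iota t x y A) = subst3 (psi \o iota) (psi t) (psi \o x) (psi y) A.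
Proof.
rewrite /subst3 rmorph_mmap; apply: eq_mmap => // i /=.
by case: unlift => // j; case: unlift.
Qed.

Lemma eq_subst3 R (iota iota' : {rmorphism F -> R}) t t' (x x' : 'I_n -> R) y y' A :
  iota =1 iota' -> t = t' -> x =1 x' -> y = y' ->
  subst3 iota t x y A = subst3 iota' t' x' y' A.
Proof.
move=> eqi -> eqx ->; apply: eq_mmap => // i.
by case: unlift => // j; case: unlift.
Qed.

Lemma filt_subst3 R (M : nat -> R -> Prop) (iota : {rmorphism F -> R})
    t (x : 'I_n -> R) y A e :
  filtration M -> (forall c, M 0%N (iota c)) ->
  M e t -> (forall i, M e (x i)) -> M e y ->
  M (tdeg A * e)%N (subst3 iota t x y A).
Proof.
move=> filtM_ Mi Mt Mx My; apply: filt_mmap => //; last exact: leqSpred.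
by move=> i; case: unlift => // j; case: unlift.
Qed.

Lemma mpoly_ring_ind m (P : {mpoly F[m]} -> Prop) :
  (forall c, P c%:MP) -> (forall i, P 'X_i) ->
  (forall p q, P p -> P q -> P (p + q)) -> (forall p q, P p -> P q -> P (p * q)) ->
  forall p, P p.
Proof.
move=> PC PX PD PM p; rewrite -[p]mmap_var /mmap.
have P0 : P 0 by rewrite -mpolyC0.
have P1 : P 1 by rewrite -mpolyC1.
elim/big_ind: _ => // M _; apply: (PM _ _) => //; rewrite /mmap1.
elim/big_ind: _ => // i _.
by elim: (M i) => [|e IH]; rewrite ?expr0 ?exprS //; apply: PM.
Qed.

Lemma coef1_subst3 R (iota : {rmorphism F -> R}) t (x : 'I_n -> R) y A :
  (subst3 (polyC \o iota) t%:P (polyC \o x) ('X + y%:P) A)`_1 =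
  subst3 iota t x y (A^`M(zvar n)).
Proof.
have coef0_subst3 B : (subst3 (polyC \o iota) t%:P (polyC \o x) ('X + y%:P) B)`_0 =
    subst3 iota t x y B.
  rewrite -horner_coef0 -[LHS]/(horner_eval 0 _) rmorph_subst3 /=.
  by apply: eq_subst3 => [c||i|] /=; rewrite /horner_eval !hornerE.
elim/mpoly_ring_ind: A => [c|i|p q IHp IHq|p q IHp IHq].
- by rewrite mderivC /subst3 rmorph0 mmapC /= coefC.
- rewrite mderivX mnm1E /subst3 mmapX mmap1U /zvar.
  case: unliftP => [j|] ->; last first.
    by rewrite [(_ == _)](_ : _ = false) // scale0r rmorph0 coefC.
  case: unliftP => [l ->|->].
    have -> : (lift ord0 (lift ord_max l) == ord_max :> 'I_n.+2) = false.
      by apply/negP => /eqP/(congr1 val) /=; rewrite /bump /=; have := ltn_ord l; lia.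
    by rewrite scale0r rmorph0 /= coefC.
  have -> : lift ord0 ord_max = ord_max :> 'I_n.+2 by apply: val_inj.
  rewrite eqxx scale1r coefD coefX coefC addr0.
  have -> : (U_(ord_max) - U_(ord_max))%MM = 0%MM :> 'X_{1..n.+2}.
    by apply/mnmP => i'; rewrite mnmBE subnn mnm0E.
  by apply: esym; rewrite mpolyX0; apply: rmorph1.
- by rewrite mderivD /subst3 !rmorphD coefD; congr (_ + _).
- rewrite mderivM /subst3 !rmorphD !rmorphM coefM big_ord_recl big_ord1 /= subn0.
  rewrite -!/(subst3 _ _ _ _ _) coef0_subst3 subnn coef0_subst3 IHp IHq.
  by rewrite addrC.
Qed.

End Subst3.

Section RegularRoot.

Variables (F : fieldType) (n k : nat) (A : {mpoly F[n.+2]}) (Phi : {poly {mpoly F[n]}}).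
Hypothesis F_char0 : [pchar F] =i pred0.
Hypothesis A_reg : T_regularized A.
Hypothesis Phi_nondeg : nondegenerate_root A Phi.
Hypothesis Phi_root : approx_root k A Phi.
Hypothesis k_gt0 : (0 < k)%N.

Lemma regular_center : exists z0 c1 : F,
  [/\ c1 != 0, Phi`_0 = z0%:MP &
      forall (R : comNzRingType) (iota : {rmorphism F -> R}) (x : 'I_n -> R),
        (subst3 (polyC \o iota) 0 (polyC \o x) ('X + (iota z0)%:P) A)`_1 = iota c1].
Proof.
have [P regP] := A_reg; have [Q rootQ] := Phi_root.
pose z0 := (Phi`_0).@[fun=> 0].
have subP (R : comNzRingType) (iota : {rmorphism F -> R}) (x : 'I_n -> R) y :
    subst3 iota 0 x y A = (map_poly iota P).[y].
  pose ev : {rmorphism {mpoly F[n]} -> R} := mmap iota x.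
  have := congr1 (horner_eval y \o map_poly ev) regP.
  rewrite [LHS](rmorph_subst3 (horner_eval y \o map_poly ev)) /=.
  rewrite -map_poly_comp /= /horner_eval rmorph0 horner0 map_polyX hornerX => subE.
  transitivity (map_poly (ev \o mpolyC n (R:=F)) P).[y]; last first.
    by congr (_.[_]); apply: eq_map_poly => c /=; rewrite mmapC.
  rewrite -subE; apply: eq_subst3 => [c||i|] //=.
    by rewrite map_polyC /horner_eval hornerC /= mmapC.
  by rewrite map_polyC /horner_eval hornerC /= mmapX mmap1U.
pose c1 := (P \Po ('X + z0%:P))`_1.
have c1E (R : comNzRingType) (iota : {rmorphism F -> R}) (x : 'I_n -> R) :
    (subst3 (polyC \o iota) 0 (polyC \o x) ('X + (iota z0)%:P) A)`_1 = iota c1.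
  rewrite subP map_poly_comp -coef_map map_comp_poly rmorphD /= map_polyX map_polyC.
  by rewrite /comp_poly.
have c1_neq0 : c1 != 0.
  have := Phi_nondeg; rewrite /nondegenerate_root horner_coef0 -/z0.
  by rewrite -coef1_subst3 (c1E _ idfun).
exists z0, c1; split=> //.
have P_neq0 : P != 0 by apply: contraNneq c1_neq0; rewrite /c1 => ->; rewrite comp_poly0 coef0.
apply: (algebraic_mpolyC F_char0 P_neq0).
rewrite -(subP _ _ (fun i => 'X_i)).
rewrite -horner_coef0; transitivity (horner_eval 0 (subst_root A Phi)).
  rewrite /subst_root rmorph_subst3; apply: eq_subst3 => [c||i|] //=;
    by rewrite /horner_eval ?hornerC ?hornerX.
by rewrite rootQ /horner_eval hornerM hornerXn expr0n eqn0Ngt k_gt0 mulr0.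
Qed.

Lemma msize_root_coef c : (c < k)%N -> (msize Phi`_c <= (k.*2 * tdeg A).+1)%N.
Proof.
have [z0 [c1 [c1_neq0 Phi0 c1E]]] := regular_center; have [Q rootQ] := Phi_root.
case: c => [|c] ltck; first by rewrite Phi0 msizeC; case: eqP.
pose iota2 : {rmorphism F -> {poly {poly {mpoly F[n]}}}} := polyC \o polyC \o @mpolyC n F.
pose q : {poly {mpoly F[n]}} := drop_poly 1 Phi.
have PhiE : Phi = 'X * q + z0%:MP%:P by rewrite -Phi0; apply: drop_polyE.
pose G := iota2 c1^-1 * subst3 iota2 ('X%:P) (fun i => ('X_i)%:P%:P) ('X + (z0%:MP)%:P%:P) A.
have := @implicit_function_filt _ _ (filt_scale (filt_msize F n) (tdeg A)) k.-1 G q.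
move=> /(_ _ _ _ c) impl.
have qE : q`_c = Phi`_c.+1 by rewrite coef_drop_poly addn1.
rewrite -qE; apply: leq_trans (impl _ _ _ _) _.
- move=> a b _; rewrite mul1n.
  have filt2 := filt_coef (filt_msize F n).
  have filt3 := filt_coef filt2.
  have C0 e : coef_filt (coef_filt (@msize_filt F n)) 0 (iota2 e).
    by apply: (coef_filtC filt2); apply: (coef_filtC (filt_msize F n)); apply: msize_filtC.
  suff : coef_filt (coef_filt (@msize_filt F n)) (0 + tdeg A * 1) G.
    by rewrite add0n muln1; apply.
  apply: (filtM filt3 (C0 _)); apply: (filt_subst3 _ filt3 C0).
  + by apply: (coef_filtC filt2); apply: (coef_filtX (filt_msize F n)).
  + move=> i; apply: (coef_filtC filt2); apply: (coef_filtC (filt_msize F n)).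
    exact: msize_filtX.
  + apply: (filtD filt3); first exact: (coef_filtX filt2).
    by apply: (coef_filtC filt2); apply: (coef_filtC (filt_msize F n)); apply: msize_filtC.
- move=> x; suff -> : G`_1`_0 = 1 by rewrite subrr mul0r; apply: filt_zero (filt_msize F n) _.
  pose ev0 : {rmorphism _ -> _} := @horner_eval {mpoly F[n]} 0.
  rewrite -horner_coef0 -[LHS]/(ev0 _) -coef_map rmorphM /= rmorph_subst3 /=.
  rewrite map_polyC coefCM /= {1}/horner_eval hornerC.
  rewrite [X in _ * X](_ : _ = c1%:MP) -?mpolyCM ?mulVf //.
  rewrite -(c1E _ (@mpolyC n F) (fun i => 'X_i)); congr (polyseq _)`_1.
  apply: eq_subst3 => [e||i|] /=.
  + by rewrite map_polyC /= /horner_eval hornerC.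
  + by rewrite map_polyC /= /horner_eval hornerX polyC0.
  + by rewrite map_polyC /= /horner_eval hornerC.
  + by rewrite rmorphD /= map_polyX map_polyC /= /horner_eval hornerC.
- move=> i lti; suff -> : (G.['X * q])`_i.+1 = 0 by apply: filt_zero (filt_msize F n) _.
  rewrite hornerM hornerC -[X in _ * X]/(horner_eval _ _) rmorph_subst3 /=.
  rewrite coefCM (_ : subst3 _ _ _ _ A = subst_root A Phi).
    by rewrite rootQ coefMXn -[k]prednK // ltnS lti mulr0.
  apply: eq_subst3 => [e||j|] /=; rewrite /horner_eval ?hornerC //.
  by rewrite hornerD hornerX hornerC -PhiE.
- by case: k ltck.
- by rewrite ltnS leq_mul2r; apply/orP; right; lia.
Qed.

Lemma msize_subst_root_coef j : truncated_root k Phi ->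
  (msize (subst_root A Phi)`_j <= (tdeg A * (k.*2 * tdeg A).+1).+1)%N.
Proof.
move=> Phi_trunc; have filtn := filt_msize F n.
suff : coef_filt (@msize_filt F n) (tdeg A * (k.*2 * tdeg A).+1) (subst_root A Phi).
  by move/(_ j).
apply: (filt_subst3 _ (filt_coef filtn)) => [c||i|i].
- by apply: (coef_filtC filtn); apply: msize_filtC.
- exact: (coef_filtX filtn).
- by apply: (coef_filtC filtn); apply: msize_filtX.
- have [ltik|leki] := ltnP i k.
    exact: (filt_leq filtn (leqnSn _) (msize_root_coef ltik)).
  by rewrite nth_default ?(leq_trans Phi_trunc) //; apply: filt_zero filtn _.
Qed.

End RegularRoot.

(** * Circuits for coefficients *)

Definition lincomb_size N s := polyval_size N 1 s.

Lemma leq_polyval_size N r s : (s <= polyval_size N r s)%N.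
Proof.
rewrite /polyval_size; apply: leq_trans (leq_pmull _ _) => //.
by rewrite mulSn; apply: leqW; apply: leq_trans (leq_addr _ _); apply: leqnSn.
Qed.

Section Coefficients.

Variables (F : fieldType) (m : nat).

Lemma computable_lincomb N (c : 'I_N -> F) (h : 'I_N -> {mpoly F[m]}) Delta s :
  (forall i, computable Delta s (h i)) ->
  computable Delta.+2 (lincomb_size N s) (\sum_i (c i)%:MP * h i).
Proof.
move=> comph; have -> : \sum_i (c i)%:MP * h i = mmap (@mpolyC m F) h (\sum_i (c i) *: 'X_i).
  by rewrite rmorph_sum; apply: eq_bigr => i _; rewrite /= mmapZ mmapX mmap1U.
apply: computable_polyval => //; apply: (filt_sum (filt_msize F N)) => i _.
by apply: leq_trans (msizeZ_le _ _) _; apply: msize_filtX.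
Qed.

Lemma computable_scale c (p : {mpoly F[m]}) Delta s :
  computable Delta s p -> computable Delta.+2 (lincomb_size 1 s) (c%:MP * p).
Proof.
move=> compp; have := @computable_lincomb 1 (fun=> c) (fun=> p) Delta s.
by rewrite big_ord1; apply.
Qed.

Lemma computable_coef (p : {poly {mpoly F[m]}}) N c Delta s :
  [pchar F] =i pred0 -> (size p <= N)%N ->
  (forall tau : F, computable Delta s p.[tau%:MP]) ->
  computable Delta.+2 (lincomb_size N s) p`_c.
Proof.
move=> F_char0 szp compp; have [tau [lam interp]] := interpolation F_char0 N.
rewrite (interp _ (@mpolyC m F)) //.
by apply: computable_lincomb => l; apply: compp.
Qed.

Lemma computable_coef2 (G : {poly {poly {mpoly F[m]}}}) N1 N2 a b Delta s :
  [pchar F] =i pred0 -> (size G <= N1)%N -> (size (G`_a)%R <= N2)%N ->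
  (forall u t : F, computable Delta s (G.[u%:MP%:P]).[t%:MP]) ->
  computable Delta.+4 (lincomb_size N2 (lincomb_size N1 s)) G`_a`_b.
Proof.
move=> F_char0 szG szGa compG; apply: computable_coef => // t.
have -> : (G`_a).[t%:MP] = (map_poly (horner_eval t%:MP) G)`_a by rewrite coef_map.
apply: computable_coef => // [|u]; first exact: leq_trans (size_poly _ _) _.
have -> : (map_poly (horner_eval t%:MP) G).[u%:MP] = (G.[u%:MP%:P]).[t%:MP].
  have {1}-> : u%:MP = horner_eval t%:MP (u%:MP%:P) :> {mpoly F[m]}.
    by rewrite /horner_eval hornerC.
  by rewrite horner_map.
exact: compG.
Qed.

Lemma computable_subst3 n (A : {mpoly F[n.+2]}) t (x : 'I_n -> {mpoly F[m]}) y
    Delta s Delta' s' :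
  computable Delta s A -> computable Delta' s' t ->
  (forall i, computable Delta' s' (x i)) -> computable Delta' s' y ->
  computable (Delta' + Delta) (s.+1 * s'.+1) (subst3 (@mpolyC m F) t x y A).
Proof.
move=> compA compt compx compy; apply: computable_comp => // i.
by case: unlift => // j; case: unlift.
Qed.

End Coefficients.

Lemma inverse_mod_Xn (F : fieldType) (p : {poly F}) k : p`_0 != 0 ->
  exists2 q : {poly F}, (size q <= k)%N & exists w : {poly F}, q * p - 1 = w * 'X^k.
Proof.
move=> p0; have coprp : coprimep p 'X^k.
  by apply: coprimep_expr; rewrite coprimepX rootE horner_coef0.
have [[u v] /= uv1] := Bezout_eq1_coprimepP _ _ coprp.
exists (u %% 'X^k).
  have : 'X^k != 0 :> {poly F} by rewrite monic_neq0 ?monicXn.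
  by rewrite -(ltn_modp u) size_polyXn ltnS.
exists (- (v + (u %/ 'X^k) * p)).
by rewrite -uv1 {2}(divp_eq u 'X^k); ring.
Qed.

Definition root_coef_size D k d s s0 :=
  lincomb_size (D * k.+1).+1 (polyval_size (d.+2 * d.+1) d.+1 (lincomb_size k
    (lincomb_size (d.*2 * (k + D * k.+1)).+1
      (polyval_size (d.+1 * d.+1) d.*2 (lincomb_size 1
        (lincomb_size (D * d).+1 (lincomb_size D.+1 (s.+1 * s0.+1)))))))).

Section RootCoefficients.

Variables (F : fieldType) (n m k d : nat).
Variables (A : {mpoly F[n.+2]}) (Phi : {poly {mpoly F[n]}}).
Variables (X : 'I_n -> {poly {mpoly F[m]}}) (xi : 'I_n -> F).
Hypothesis F_char0 : [pchar F] =i pred0.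
Hypothesis A_reg : T_regularized A.
Hypothesis Phi_nondeg : nondegenerate_root A Phi.
Hypothesis Phi_root : approx_root k A Phi.
Hypothesis Phi_trunc : truncated_root k Phi.
Hypothesis k_gt0 : (0 < k)%N.
Hypothesis X0 : forall i, (X i)`_0 = (xi i)%:MP.

Let L : comNzRingType := {mpoly F[m]}.
Let R : comNzRingType := {poly L}.

Let iT : {rmorphism F -> R} := polyC \o @mpolyC m F.
Let it : {rmorphism F -> {poly R}} := polyC \o iT.
Let iu : {rmorphism F -> {poly {poly R}}} := polyC \o it.
Let Xt i : {poly R} := map_poly polyC (X i).
Let ev : {rmorphism {mpoly F[n]} -> {poly R}} := mmap it Xt.

(* In [{poly {poly {mpoly F[m]}}}] the outer variable is [t] and the inner one
   is [T]; [evT S] is [S(T, X(t))]. *)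
Definition evT : {rmorphism {poly {mpoly F[n]}} -> {poly R}} :=
  horner_eval 'X%:P \o map_poly ev.

Definition at_X : {rmorphism {mpoly F[n]} -> {poly L}} := mmap (polyC \o @mpolyC m F) X.

Lemma coef_evT S b j : (evT S)`_b`_j = (at_X S`_j)`_b.
Proof.
have evE p : ev p = map_poly polyC (at_X p).
  rewrite /ev /at_X /= rmorph_mmap; apply: eq_mmap => [c|i] //=.
  by rewrite map_polyC.
rewrite /evT /= /horner_eval (@horner_coef_wide _ (maxn (size S) j.+1)); last first.
  exact: leq_trans (size_poly _ _) (leq_maxl _ _).
rewrite coef_sum coef_sum (bigD1 (Ordinal (leq_maxr (size S) j.+1))) //= big1 ?addr0.
  by rewrite coef_map /= evE -rmorphXn coefMC coef_map /= coefMXn ltnn subnn coefC.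
move=> i; rewrite -val_eqE /= => ne_ij.
rewrite coef_map /= evE -rmorphXn coefMC coef_map /= coefCM coefXn eq_sym.
by rewrite (negPf ne_ij) mulr0.
Qed.

Let Ph := evT Phi.
Let G0 : {poly {poly R}} :=
  subst3 iu 'X%:P%:P (polyC \o Xt) ('X + (Ph`_0)%:P%:P) A.

Lemma horner_G0 y : G0.[y] = subst3 it 'X%:P Xt (y + (Ph`_0)%:P) A.
Proof.
rewrite -[LHS]/(horner_eval y _) rmorph_subst3.
apply: eq_subst3 => [c||i|] /=; rewrite /horner_eval ?hornerC //.
by rewrite hornerD hornerX hornerC.
Qed.

Lemma subst3_Ph : subst3 it 'X%:P Xt Ph A = evT (subst_root A Phi).
Proof.
rewrite /subst_root [RHS]rmorph_subst3 /evT; apply: eq_subst3 => [c||i|] //=.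
- by rewrite map_polyC /horner_eval hornerC /= mmapC.
- by rewrite map_polyX /horner_eval hornerX.
- by rewrite map_polyC /horner_eval hornerC /= mmapX mmap1U.
Qed.

Let q := drop_poly 1 Ph.

Lemma horner_G0_q : G0.['X * q] = evT (subst_root A Phi).
Proof. by rewrite horner_G0 -drop_polyE subst3_Ph. Qed.

Let phi0 : {poly F} := map_poly (meval xi) Phi.

Lemma Ph0E : Ph`_0 = map_poly (@mpolyC m F) phi0.
Proof.
apply/polyP => j; rewrite coef_evT !coef_map /= -horner_coef0.
rewrite -[LHS]/(horner_eval 0 _) /at_X /= rmorph_mmap /meval rmorph_mmap.
apply: eq_mmap => [c|i] /=; rewrite /horner_eval ?hornerC //.
by rewrite horner_coef0 X0.
Qed.

Lemma size_Ph_coef b : (size (Ph`_b)%R <= k)%N.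
Proof.
apply/leq_sizeP => j lekj; rewrite coef_evT.
have -> : Phi`_j = 0 by rewrite nth_default ?(leq_trans Phi_trunc).
by rewrite rmorph0 coef0.
Qed.

Lemma G0_10 : exists2 delta : {poly F}, delta`_0 != 0 &
  G0`_1`_0 = map_poly (@mpolyC m F) delta.
Proof.
have [z0 [c1 [c1_neq0 Phi0 c1E]]] :=
  regular_center F_char0 A_reg Phi_nondeg Phi_root k_gt0.
pose D : {poly {poly F}} := subst3 (polyC \o polyC) 'X%:P
  (fun i => (xi i)%:P%:P) ('X + phi0%:P) A.
have D1 : (D`_1)`_0 = c1.
  rewrite -horner_coef0 -[(D`_1).[0]]/(horner_eval 0 _) -coef_map /D rmorph_subst3.
  apply: etrans (c1E _ idfun xi); congr (polyseq _)`_1; apply: eq_subst3 => [c||i|] /=.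
  - by rewrite map_polyC /= /horner_eval hornerC.
  - by rewrite map_polyC /= /horner_eval hornerX.
  - by rewrite map_polyC /= /horner_eval hornerC.
  - rewrite rmorphD /= map_polyX map_polyC /= /horner_eval horner_coef0.
    by rewrite coef_map Phi0 /= mevalC.
exists D`_1; first by rewrite D1.
pose psi : {rmorphism {poly {poly F}} -> {poly R}} := map_poly (map_poly (@mpolyC m F)).
transitivity (psi D)`_1; last by rewrite coef_map.
rewrite -horner_coef0 -[LHS]/(horner_eval 0 _) -coef_map.
rewrite [map_poly _ _]rmorph_subst3 rmorph_subst3.
congr (polyseq _)`_1; apply: eq_subst3 => [c||i|] /=.
- by rewrite !map_polyC /= /horner_eval hornerC map_polyC.
- by rewrite !map_polyC /= /horner_eval hornerC map_polyX.
- by rewrite !map_polyC /= /horner_eval horner_coef0 coef_map X0 map_polyC.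
- by rewrite !rmorphD /= !map_polyX !map_polyC /= /horner_eval hornerC Ph0E.
Qed.

Let D := tdeg A.

Lemma size_G0_coef a b : size_filt (D * k.+1) G0`_a`_b.
Proof.
have filt1 := filt_size L; have filt2 := filt_coef filt1; have filt3 := filt_coef filt2.
suff : coef_filt (coef_filt (@size_filt L)) (D * k.+1) G0 by apply.
apply: (filt_subst3 _ filt3) => [c||i|].
- by apply: (coef_filtC filt2); apply: (coef_filtC filt1); apply: size_filtC.
- by apply: (coef_filtC filt2); apply: (coef_filtC filt1); apply: size_filtX.
- apply: (coef_filtC filt2) => c; rewrite coef_map; exact: size_filtC.
- apply: (filtD filt3); first exact: (coef_filtX filt2).
  apply: (coef_filtC filt2); apply: (coef_filtC filt1).
  by apply: leq_trans (size_Ph_coef 0) _; lia.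
Qed.

Variables (Delta s Delta0 s0 : nat).
Hypothesis compA : computable Delta s A.
Hypothesis sizeX : forall i, (size (X i) <= d.+1)%N.
Hypothesis compX : forall i (t : F), computable Delta0 s0 (X i).[t%:MP].

Let s1 := lincomb_size (D * d).+1 (lincomb_size D.+1 (s.+1 * s0.+1)).

Lemma computable_G0 a b (tau : F) :
  computable (Delta0 + Delta).+4 s1 (G0`_a`_b).[tau%:MP].
Proof.
pose ie : {rmorphism F -> {poly {poly L}}} := polyC \o polyC \o @mpolyC m F.
pose G : {poly {poly L}} := subst3 ie (tau%:MP%:P%:P) (polyC \o X)
  ('X + (phi0.[tau])%:MP%:P%:P) A.
have -> : (G0`_a`_b).[tau%:MP] = G`_a`_b.
  have -> : G = map_poly (map_poly (horner_eval tau%:MP)) G0.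
    rewrite rmorph_subst3; apply: eq_subst3 => [c||i|] /=.
    - by do 2!rewrite map_polyC /=; rewrite /horner_eval hornerC.
    - by do 2!rewrite map_polyC /=; rewrite /horner_eval hornerX.
    - rewrite map_polyC /= -map_poly_comp map_poly_id // => c _ /=.
      by rewrite /horner_eval hornerC.
    - rewrite rmorphD /= map_polyX; do 2!rewrite map_polyC /=.
      by rewrite Ph0E /horner_eval horner_map.
  by rewrite !coef_map.
have filt1 := filt_size L; have filt2 := filt_coef filt1.
apply: computable_coef2 => //.
- rewrite -[D]muln1; apply: (filt_subst3 _ (filt_size _)) => [c||i|].
  + exact: size_filtC.
  + exact: size_filtC.
  + exact: size_filtC.
  + by apply: (filtD (filt_size _)); [apply: size_filtX | apply: size_filtC].
- suff : coef_filt (@size_filt L) (D * d) G by apply.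
  apply: (filt_subst3 _ filt2) => [c||i|].
  + by apply: (coef_filtC filt1); apply: size_filtC.
  + by apply: (coef_filtC filt1); apply: size_filtC.
  + by apply: (coef_filtC filt1); apply: sizeX.
  + apply: (filtD filt2); first exact: (coef_filtX filt1).
    by apply: (coef_filtC filt1); apply: size_filtC.
- move=> u t; have -> : (G.[u%:MP%:P]).[t%:MP] =
      subst3 (@mpolyC m F) tau%:MP (fun i => (X i).[t%:MP]) (u + phi0.[tau])%:MP A.
    rewrite -[LHS]/((horner_eval t%:MP \o horner_eval u%:MP%:P) _) rmorph_subst3.
    apply: eq_subst3 => [c||i|] /=; rewrite /horner_eval ?hornerC //.
    by rewrite hornerD hornerX hornerC hornerD !hornerC mpolyCD.
  apply: computable_subst3 => //; exact: computable_weaken (computableC _ _).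
Qed.

Let h (eta : {poly F}) (l : 'I_(d.+1 * d.+1)) : R :=
  map_poly (@mpolyC m F) eta * G0`_(l %/ d.+1)`_(l %% d.+1).

Lemma Ph_coef_polyval : exists2 eta : {poly F}, (size eta <= k)%N &
  forall i, (i < d)%N ->
    polyval_mod iT (h eta) (fun x => exists y, x = y * 'X^k) i.*2.+1 Ph`_i.+1.
Proof.
have [delta delta0 G10] := G0_10; have [Q rootQ] := Phi_root.
have [eta sz_eta [w etaE]] := inverse_mod_Xn k delta0.
exists eta => // i ltid; pose eta' := map_poly (@mpolyC m F) eta.
have idX : ideal (fun x : R => exists y, x = y * 'X^k) := @ideal_Xn L k.
pose G := eta'%:P%:P * G0.
have GE a b : G`_a`_b = eta' * G0`_a`_b by rewrite !coefCM.
have qE : q`_i = Ph`_i.+1 by rewrite coef_drop_poly addn1.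
rewrite -qE; apply: (implicit_function_filt (filt_polyval iT (h eta) idX) (N := d) (G := G)) => //.
- move=> a b leab; rewrite GE.
  have ltl : (a * d.+1 + b < d.+1 * d.+1)%N by nia.
  have -> : eta' * G0`_a`_b = h eta (Ordinal ltl); last exact: polyval_gen.
  have ltb : (b < d.+1)%N by lia.
  by rewrite /h /= divnMDl // divn_small // addn0 modnMDl modn_small.
- move=> x; apply: polyval_ideal => //; exists (map_poly (@mpolyC m F) w * x).
  rewrite GE G10 /eta' -rmorphM -(rmorph1 (map_poly (@mpolyC m F))) -rmorphB etaE.
  by rewrite rmorphM /= map_polyXn mulrAC.
- move=> j _; apply: (filt_leq (filt_polyval iT (h eta) idX) (leq0n _)).
  apply: polyval_ideal => //; exists (eta' * (evT Q)`_j.+1).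
  rewrite hornerM hornerC horner_G0_q rootQ rmorphM rmorphXn coefCM -mulrA.
  rewrite [X in _ * X ^+ k](_ : _ = 'X%:P); last first.
    by rewrite /evT /= map_polyX /horner_eval hornerX.
  by rewrite -rmorphXn coefMC.
Qed.

Let s2 := polyval_size (d.+1 * d.+1) d.*2 (lincomb_size 1 s1).
Let s3 := lincomb_size (d.*2 * (k + D * k.+1)).+1 s2.

Lemma computable_Ph_coef b c : (b <= d)%N ->
  computable ((Delta0 + Delta) + 10) s3 ((Ph`_b)`_c).
Proof.
case: b => [_|b ltbd].
  rewrite Ph0E coef_map; exact: computable_weaken (computableC _ _).
have [lekc|ltck] := leqP k c.
  rewrite nth_default ?(leq_trans (size_Ph_coef _)) // -mpolyC0.
  exact: computable_weaken (computableC _ _).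
have [eta sz_eta /(_ b ltbd)[P szP [y PhE]]] := Ph_coef_polyval.
have -> : (Ph`_b.+1)`_c = (mmap iT (h eta) P)`_c.
  by apply/eqP; rewrite -subr_eq0 -coefB PhE coefMXn ltck.
apply: (computable_weaken (Delta := (Delta0 + Delta).+4.+2.+2.+2) _ (leqnn _)); first by lia.
have filt1 := filt_size L.
have szP' : (msize P <= d.*2.+1)%N by apply: leq_trans szP _; lia.
apply: computable_coef => //.
  apply: (filt_mmap filt1 _ _ szP') => [e|l]; first exact: size_filtC.
  apply: (filtM filt1); last exact: size_G0_coef.
  by apply: leq_trans (size_poly _ _) _; apply: leq_trans sz_eta _.
move=> tau; rewrite -[_.[_]]/(horner_eval tau%:MP _) rmorph_mmap.
rewrite (eq_mmap _ (iota' := @mpolyC m F) (v' := fun l => (h eta l).[tau%:MP])) //; last first.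
  by move=> e; rewrite /= /horner_eval hornerC.
apply: computable_polyval => // l; rewrite /h hornerM.
by rewrite [(map_poly _ _).[_]]horner_map; apply: computable_scale; apply: computable_G0.
Qed.

Lemma computable_Ph b (tau : F) : (b <= d)%N ->
  computable ((Delta0 + Delta) + 12) (lincomb_size k s3) (Ph`_b).[tau%:MP].
Proof.
move=> lebd; rewrite (horner_coef_wide _ (size_Ph_coef _)).
have -> : \sum_(c < k) Ph`_b`_c * tau%:MP ^+ c = \sum_(c < k) (tau ^+ c)%:MP * Ph`_b`_c.
  by apply: eq_bigr => c _; rewrite rmorphXn mulrC.
rewrite !addnS; apply: computable_lincomb => c.
by rewrite -!addnS; apply: computable_Ph_coef.
Qed.

Lemma computable_at_X j b : (b <= d)%N ->
  computable ((Delta0 + Delta) + 16) (root_coef_size D k d s s0)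
    (at_X (subst_root A Phi)`_j)`_b.
Proof.
move=> lebd; rewrite -coef_evT -subst3_Ph.
set B := subst3 _ _ _ _ _; have filt1 := filt_size L; have filt2 := filt_coef filt1.
apply: (computable_weaken (Delta := ((Delta0 + Delta) + 14).+2) _ (leqnn _)); first by lia.
apply: computable_coef => //.
  suff : coef_filt (@size_filt L) (D * k.+1) B by apply.
  apply: (filt_subst3 _ filt2) => [c||i|].
  - by apply: (coef_filtC filt1); apply: size_filtC.
  - by apply: (coef_filtC filt1); apply: size_filtX.
  - by move=> c; rewrite coef_map; exact: size_filtC.
  - by move=> c; apply: leq_trans (size_Ph_coef c) _; lia.
move=> tau; have BE : B = G0.['X * q] by rewrite horner_G0 -drop_polyE.
pose ev_t : {rmorphism R -> L} := horner_eval tau%:MP.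
pose Gt := map_poly (map_poly ev_t) G0; pose qt := map_poly ev_t q.
have -> : (B`_b).[tau%:MP] = (Gt.['X * qt])`_b.
  rewrite -[LHS]/(ev_t _) -coef_map BE -horner_map rmorphM /= map_polyX.
  by [].
pose h2 (l : 'I_(d.+2 * d.+1)) : L :=
  if (l %/ d.+1 == d.+1)%N then if (l %% d.+1 < d)%N then qt`_(l %% d.+1) else 0
  else Gt`_(l %/ d.+1)`_(l %% d.+1).
have [P szP /eqP] : polyval_mod (@mpolyC m F) h2 (fun x => x = 0) d.+1 (Gt.['X * qt])`_b.
  apply: (filt_coef_horner (filt_polyval _ h2 (@ideal_zero L)) (N := d)) => //.
  - move=> a c leac; have ltl : (a * d.+1 + c < d.+2 * d.+1)%N by nia.
    have ltc : (c < d.+1)%N by lia.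
    have -> : Gt`_a`_c = h2 (Ordinal ltl); last exact: polyval_gen (@ideal_zero L) _.
    rewrite /h2 /= divnMDl // divn_small // addn0 modnMDl modn_small //.
    by rewrite ltn_eqF //; lia.
  - move=> i ltid; have ltl : (d.+1 * d.+1 + i < d.+2 * d.+1)%N by nia.
    have lti : (i < d.+1)%N by lia.
    have -> : qt`_i = h2 (Ordinal ltl); last exact: polyval_gen (@ideal_zero L) _.
    by rewrite /h2 /= divnMDl // divn_small // addn0 modnMDl modn_small // eqxx ltid.
rewrite subr_eq0 => /eqP ->.
rewrite !addnS; apply: computable_polyval => // l; rewrite -!addnS.
have ltmod : (l %% d.+1 <= d)%N by rewrite -ltnS ltn_pmod.
rewrite /h2; case: eqP => [_|_].
  case: ifP => [ltd|_]; last first.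
    by rewrite -mpolyC0; apply: computable_weaken (computableC _ _).
  rewrite coef_map /= coef_drop_poly addn1; exact: computable_Ph.
rewrite !coef_map; apply: computable_weaken (computable_G0 _ _ _); first by lia.
rewrite /s3 /s2 /lincomb_size.
by do 4!(apply: leq_trans _ (leq_polyval_size _ _ _)).
Qed.

End RootCoefficients.

(** * Extraction of a root *)

Lemma coef_comp_XaddC (R : comNzRingType) (p : {poly R}) c j :
  (p \Po ('X + c%:P))`_j = p^`N(j).[c].
Proof.
have -> : p \Po ('X + c%:P) = \sum_(i < size p) (p^`N(i).[c])%:P * 'X^i.
  rewrite /comp_poly addrC nderiv_taylor; last exact: mulrC.
  rewrite size_map_polyC; apply: eq_bigr => i _.
  by rewrite nderivn_map horner_map.
rewrite coef_sum; have [ltj|lej] := ltnP j (size p); last first.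
  rewrite nderivn_poly0 // horner0 big1 // => i _.
  by rewrite coefCM coefXn gtn_eqF ?mulr0 // (leq_trans _ lej).
rewrite (bigD1 (Ordinal ltj)) //= coefCM coefXn eqxx mulr1 big1 ?addr0 // => i.
by rewrite -val_eqE /= coefCM coefXn eq_sym => /negPf ->; rewrite mulr0.
Qed.

Lemma deriv_nderivn (R : nzRingType) (p : {poly R}) j :
  (p^`N(j))^`() = p^`N(j.+1) *+ j.+1.
Proof.
apply/polyP => i; rewrite coef_deriv coefMn !coef_nderivn -!mulrnA addSnnS.
by congr (_ *+ _); rewrite -[RHS]mulnC mul_bin_left mulnC -addSnnS addSn subSn ?leq_addr // addKn.
Qed.

Definition shift_poly (F : fieldType) m (a : 'I_m -> F) :
    {rmorphism {mpoly F[m]} -> {poly {mpoly F[m]}}} :=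
  mmap (polyC \o @mpolyC m F) (fun l => (a l)%:MP%:P + ('X_l)%:P * 'X).

Section Shift.

Variables (F : fieldType) (m : nat) (a : 'I_m -> F).
Implicit Types p : {mpoly F[m]}.

Lemma horner_shift p (t : F) :
  (shift_poly a p).[t%:MP] = mmap (@mpolyC m F) (fun l => (a l)%:MP + t%:MP * 'X_l) p.
Proof.
rewrite -[LHS]/(horner_eval t%:MP _) rmorph_mmap; apply: eq_mmap => [c|l] /=;
  by rewrite /horner_eval !hornerE // mulrC.
Qed.

Lemma coef0_shift p : (shift_poly a p)`_0 = (p.@[a])%:MP.
Proof.
rewrite -horner_coef0 -[X in _.[X]]mpolyC0 horner_shift /meval rmorph_mmap.
by apply: eq_mmap => // l /=; rewrite mpolyC0 mul0r addr0.
Qed.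

Lemma size_shift p d : (msize p <= d.+1)%N -> (size (shift_poly a p) <= d.+1)%N.
Proof.
move=> szp; rewrite -[d in X in (_ <= X)%N]muln1.
apply: (filt_mmap (filt_size _)) szp => [c|l]; first exact: size_filtC.
apply: (filtD (filt_size _)); first exact: size_filtC.
rewrite -[1%N]add0n; apply: (filtM (filt_size _)); first exact: size_filtC.
exact: size_filtX.
Qed.

Lemma unshift p : mmap (@mpolyC m F) (fun l => 'X_l - (a l)%:MP) (shift_poly a p).[1] = p.
Proof.
rewrite -mpolyC1 horner_shift rmorph_mmap -[RHS]mmap_var; apply: eq_mmap => [c|l] /=.
  by rewrite mmapC.
by rewrite mpolyC1 mul1r rmorphD /= mmapC mmapX mmap1U addrC subrK.
Qed.

End Shift.

Definition extraction_size E d s :=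
  ((polyval_size (d.+1 * d.+1) d.*2 (lincomb_size 1 (lincomb_size d.+1
     (lincomb_size E.+1 s)))).+1 * 7)%N.

Section RootExtraction.

Variables (F : fieldType) (n m d E : nat) (f : {mpoly F[n]}) (i0 : 'I_n).
Variables (x : 'I_n -> {mpoly F[m]}) (g : {mpoly F[m]}).
Hypothesis F_char0 : [pchar F] =i pred0.
Hypothesis szf : (msize f <= E.+1)%N.
Hypothesis szg : (msize g <= d.+1)%N.

Let L : comNzRingType := {mpoly F[m]}.

Definition partial_subst : {poly L} :=
  mmap (polyC \o @mpolyC m F) (fun j => if j == i0 then 'X else (x j)%:P) f.

Definition line_point (a : 'I_m -> F) (y nu : F) (j : 'I_n) : {poly L} :=
  if j == i0 then y%:MP%:P + nu%:MP%:P * 'X else shift_poly a (x j).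

Hypothesis fy_neq0 : partial_subst != 0.
Hypothesis fy_root : partial_subst.[g] = 0.

Lemma simple_root_derivative : exists j,
  partial_subst^`N(j).[g] = 0 /\ (partial_subst^`N(j))^`().[g] != 0.
Proof.
pose P j := partial_subst^`N(j).[g] != 0.
have exP : exists j, P j.
  exists (size partial_subst).-1; rewrite /P.
  suff -> : partial_subst^`N((size partial_subst).-1) = (lead_coef partial_subst)%:P.
    by rewrite hornerC lead_coef_eq0.
  apply/polyP => -[|i]; rewrite coef_nderivn coefC /= ?addn0 ?binn //.
  by rewrite nth_default ?mul0rn // addnS -addSn prednK ?leq_addr // lt0n size_poly_eq0.
have [[|j] Pj minj] := ex_minnP exP.
  by move: Pj; rewrite /P nderivn0 fy_root eqxx.
exists j; split.
  by apply/eqP/negPn/negP => /minj; rewrite ltnn.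
rewrite deriv_nderivn hornerMn -mulr_natr mulf_neq0 //.
by rewrite -mpolyC_nat mpolyC_eq0 (proj1 (pcharf0P F) F_char0).
Qed.

Lemma at_line_point a y nu :
  at_X (line_point a y nu) f =
  (map_poly (shift_poly a) partial_subst).[y%:MP%:P + nu%:MP%:P * 'X].
Proof.
rewrite -[RHS]/((horner_eval _ \o map_poly (shift_poly a)) _) rmorph_mmap.
apply: eq_mmap => [c|j] /=.
  by rewrite map_polyC /horner_eval hornerC /= mmapC.
rewrite /line_point; case: eqP => _; first by rewrite map_polyX /horner_eval hornerX.
by rewrite map_polyC /horner_eval hornerC.
Qed.

Variables (Delta s : nat).
Hypothesis compf : forall a y nu b, (b <= d)%N ->
  computable Delta s (at_X (line_point a y nu) f)`_b.

Lemma size_partial_subst : (size partial_subst <= E.+1)%N.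
Proof.
rewrite -[E in X in (_ <= X)%N]muln1.
apply: (filt_mmap (filt_size _)) szf => [c|j]; first exact: size_filtC.
by case: eqP => _; [apply: size_filtX | apply: size_filtC].
Qed.

Lemma computable_nderivn_line a y nu j b : (b <= d)%N ->
  computable Delta.+2 (lincomb_size E.+1 s)
    ((map_poly (shift_poly a) partial_subst^`N(j)).[y%:MP%:P + nu%:MP%:P * 'X])`_b.
Proof.
move=> lebd; set fs := map_poly (shift_poly a) partial_subst.
pose c := y%:MP%:P + nu%:MP%:P * 'X : {poly L}.
rewrite -nderivn_map -coef_comp_XaddC.
have [tau [lam interp]] := interpolation F_char0 E.+1.
have szfs : (size fs <= E.+1)%N.
  exact: leq_trans (size_poly _ _) size_partial_subst.
rewrite (interp _ (polyC \o @mpolyC m F)) /=; last first.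
  apply: leq_trans (size_comp_poly_leq _ _) _.
  by rewrite size_XaddC muln1 ltnS; case: (size fs) szfs.
rewrite coef_sum.
rewrite (eq_bigr (fun l => (lam j l)%:MP * (at_X (line_point a (y + tau l) nu) f)`_b)).
  by apply: computable_lincomb => l; apply: compf.
move=> l _; rewrite coefCM at_line_point horner_comp hornerD hornerX hornerC /c /=.
by rewrite mpolyCD polyCD addrA [y%:MP%:P + _]addrC.
Qed.

Lemma computable_taylor a y j e b : (e + b <= d)%N ->
  computable Delta.+4 (lincomb_size d.+1 (lincomb_size E.+1 s))
    (map_poly (shift_poly a) partial_subst^`N(j) \Po ('X + y%:MP%:P%:P))`_e`_b.
Proof.
move=> leebd; set K := _ \Po _.
pose pe : {poly L} := \poly_(i < (e + b).+1) K`_i`_(e + b - i).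
have -> : K`_e`_b = pe`_e by rewrite coef_poly ltnS leq_addr addKn.
apply: computable_coef => // [|nu].
  by apply: leq_trans (size_poly _ _) _; rewrite ltnS.
have -> : pe.[nu%:MP] =
    ((map_poly (shift_poly a) partial_subst^`N(j)).[y%:MP%:P + nu%:MP%:P * 'X])`_(e + b).
  have -> : (map_poly (shift_poly a) partial_subst^`N(j)).[y%:MP%:P + nu%:MP%:P * 'X]
      = K.['X * nu%:MP%:P].
    by rewrite horner_comp !hornerE addrC ['X * _]mulrC.
  rewrite (@horner_coef_wide _ (e + b).+1) ?size_poly //.
  rewrite (@horner_coef_wide _ (maxn (size K) (e + b).+1)) ?leq_maxl // coef_sum.
  rewrite (big_ord_widen _ (fun i => pe`_i * nu%:MP ^+ i) (leq_maxr (size K) (e + b).+1)).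
  rewrite big_mkcond; apply: eq_bigr => i _.
  have -> : ('X * nu%:MP%:P) ^+ i = 'X^i * (nu%:MP ^+ i)%:P :> {poly L}.
    by rewrite exprMn rmorphXn.
  rewrite coef_poly mulrA coefMC coefMXn !ltnS.
  by case: leqP => //; rewrite mul0r.
exact: computable_nderivn_line.
Qed.

Lemma computable_root : computable (Delta + 9) (extraction_size E d s) g.
Proof.
have [j [rootj simplej]] := simple_root_derivative.
set f2 := partial_subst^`N(j) in rootj simplej.
have [a wa] := mpoly_neq0_eval F_char0 simplej.
set w := (f2^`().[g]).@[a] in wa.
pose y := g.@[a]; pose q := drop_poly 1 (shift_poly a g).
have qE : shift_poly a g = 'X * q + y%:MP%:P by rewrite -coef0_shift; apply: drop_polyE.
pose K := map_poly (shift_poly a) f2 \Po ('X + y%:MP%:P%:P).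
pose G := w^-1%:MP%:P%:P * K.
have GE e b : G`_e`_b = w^-1%:MP * K`_e`_b by rewrite !coefCM.
have K_root : K.['X * q] = 0.
  by rewrite horner_comp !hornerE -qE horner_map rootj rmorph0.
have K10 : K`_1`_0 = w%:MP.
  rewrite coef_comp_XaddC nderivn1 -horner_coef0 -[LHS]/(horner_eval 0 _).
  rewrite deriv_map /w -coef0_shift -[RHS]horner_coef0 -[RHS]/(horner_eval 0 _).
  rewrite -[X in _ = horner_eval 0 X]horner_map -!horner_map; congr (_.[_]).
  by rewrite /= /horner_eval hornerC horner_coef0 coef0_shift.
pose h (l : 'I_(d.+1 * d.+1)) : L :=
  if (l %/ d.+1 + l %% d.+1 <= d)%N then G`_(l %/ d.+1)`_(l %% d.+1) else 0.
have filth := filt_polyval (@mpolyC m F) h (@ideal_zero L).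
have q_polyval i : (i < d)%N -> polyval_mod (@mpolyC m F) h (fun x => x = 0) i.*2.+1 q`_i.
  apply: (implicit_function_filt filth (N := d) (G := G)) => [e b leeb|z|i' _].
  - have ltl : (e * d.+1 + b < d.+1 * d.+1)%N by nia.
    have ltb : (b < d.+1)%N by lia.
    have -> : G`_e`_b = h (Ordinal ltl); last exact: polyval_gen (@ideal_zero L) _.
    by rewrite /h /= divnMDl // divn_small // addn0 modnMDl modn_small // leeb.
  - rewrite GE K10 -mpolyCM mulVf // mpolyC1 subrr mul0r; exact: filt0 filth.
  - by rewrite hornerM K_root mulr0 coef0; apply: filt_zero filth _.
have [P szP /eqP] : polyval_mod (@mpolyC m F) h (fun x => x = 0) d.*2 (shift_poly a g).[1].
  rewrite (horner_coef_wide _ (size_shift a szg)).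
  apply: (filt_sum filth) => -[[|i] /= lti] _; rewrite expr1n mulr1.
    rewrite coef0_shift; apply: (filt_leq filth (leq0n _)).
    exact: polyval_const (@ideal_zero L) _.
  have -> : (shift_poly a g)`_i.+1 = q`_i by rewrite coef_drop_poly addn1.
  by apply: (filt_leq filth _ (q_polyval i _)); lia.
rewrite subr_eq0 => /eqP gE; rewrite -(unshift a g) gE.
rewrite /extraction_size.
apply: (computable_weaken (Delta := (1 + Delta.+4.+2.+2)%N) _ (leqnn _)); first by lia.
apply: (computable_comp (s' := 6)) => [|l].
  apply: computable_polyval => // l; rewrite /h; case: ifP => [lel|_]; last first.
    by rewrite -mpolyC0; apply: computable_weaken (computableC _ _).
  by rewrite GE; apply: computable_scale; apply: computable_taylor.
have -> : 'X_l - (a l)%:MP = \sum_(p <- [:: 'X_l; (- a l)%:MP]) p :> {mpoly F[m]}.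
  by rewrite big_cons big_seq1 mpolyCN.
apply: computable_weaken (leqnn _) _ (computable_sum (Delta := 0) (s := 1) _) => // p.
rewrite !inE => /orP[]/eqP ->.
  exact: computable_weaken (computableX _ _).
exact: computable_weaken (computableC _ _).
Qed.

End RootExtraction.

(** * The hybrid argument *)

Definition sparse_restriction (F : fieldType) sigma rho (g p : {mpoly F[sigma]}) :=
  (exists c, p = c%:MP) \/
  exists (v : 'I_sigma -> {mpoly F[sigma]}) (V : {set 'I_sigma}),
    [/\ (#|V| < rho)%N, forall l, (exists c, v l = c%:MP) \/ exists2 p, p \in V & v l = 'X_p
      & p = mmap (@mpolyC sigma F) v g].

Lemma exists_step (P : nat -> Prop) n : P 0%N -> ~ P n ->
  exists2 i, (i < n)%N & P i /\ ~ P i.+1.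
Proof.
elim: n => [|n IH] P0 nPn //; have [Pn|nP] := classic (P n); first by exists n.
by have [i lti Pi] := IH P0 nP; exists i => //; apply: leqW.
Qed.

Section Hybrid.

Variables (F : fieldType) (n sigma mu rho : nat) (S : 'I_n -> {set 'I_mu}).
Variables (g : {mpoly F[sigma]}) (f : {mpoly F[n]}).
Hypothesis F_char0 : [pchar F] =i pred0.
Hypothesis S_design : design sigma rho S.
Hypothesis f_neq0 : f != 0.
Hypothesis f_KI : f \mPo KI g S = 0.

Let cardS i : #|S i| = sigma. Proof. by case: S_design. Qed.

Let pos i (l : 'I_sigma) : 'I_mu := enum_val (cast_ord (esym (cardS i)) l).

Let pos_inj i : injective (pos i).
Proof. by move=> l l' /enum_val_inj/cast_ord_inj. Qed.

Let posP i l : pos i l \in S i.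
Proof. exact: enum_valP. Qed.

Let eval_KI i w : (tnth (KI g S) i).@[w] = g.@[fun l => w (pos i l)].
Proof.
rewrite tnth_mktuple comp_mpoly_meval; apply: meval_eq => l.
rewrite tnth_mktuple (nth_map (pos i l)) ?mevalXU; last by rewrite -cardE cardS.
by congr (w _); rewrite [RHS]/pos (enum_val_nth (pos i l)).
Qed.

Let hybrid (w : 'I_mu -> F) (xi : 'I_n -> F) k (j : 'I_n) : F :=
  if (j < k)%N then g.@[fun l => w (pos j l)] else xi j.

Lemma hybrid_argument : exists (i0 : 'I_n) (x : 'I_n -> {mpoly F[sigma]}),
  [/\ partial_subst f i0 x != 0, (partial_subst f i0 x).[g] = 0
    & forall j, sparse_restriction rho g (x j)].
Proof.
pose P k := exists w xi, f.@[hybrid w xi k] != 0.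
have [||i lti [[w [xi fi]] nPi]] := @exists_step P n.
- have [xi fxi] := mpoly_neq0_eval F_char0 f_neq0.
  by exists (fun=> 0), xi.
- case=> w [xi /eqP]; apply.
  rewrite -[RHS](meval0 w) -f_KI comp_mpoly_meval; apply: meval_eq => j.
  by rewrite eval_KI /hybrid ltn_ord.
pose i0 := Ordinal lti.
pose v (j : 'I_n) l : {mpoly F[sigma]} :=
  if [pick p | pos i0 p == pos j l] is Some p then 'X_p else (w (pos j l))%:MP.
pose x (j : 'I_n) := if (j < i)%N then mmap (@mpolyC sigma F) (v j) g else (xi j)%:MP.
have eval_x u (j : 'I_n) : (x j).@[u] =
    if (j < i)%N then g.@[fun l => (v j l).@[u]] else xi j.
  rewrite /x; case: ifP => _; last by rewrite mevalC.
  rewrite {1}/meval rmorph_mmap; apply: eq_mmap => // c /=; exact: mevalC.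
have eval_partial u y : (map_poly (meval u) (partial_subst f i0 x)).[y] =
    f.@[fun j => if j == i0 then y else (x j).@[u]].
  rewrite -[LHS]/((horner_eval y \o map_poly (meval u)) _) rmorph_mmap.
  apply: eq_mmap => [c|j] /=; first by rewrite map_polyC /horner_eval hornerC /= mevalC.
  by case: eqP => _; rewrite ?map_polyX ?map_polyC /horner_eval ?hornerX ?hornerC.
exists i0, x; split.
- apply: contraNneq fi => px0.
  have := eval_partial (fun l => w (pos i0 l)) (xi i0); rewrite px0 rmorph0 horner0 => ->.
  apply/eqP; apply: meval_eq => j; rewrite eval_x /hybrid.
  case: eqP => [->|_]; first by rewrite ltnn.
  case: ifP => // _; apply: meval_eq => l; rewrite /v.
  by case: pickP => [p /eqP <-|_]; rewrite ?mevalXU ?mevalC.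
- apply: (mpoly_eval_eq0 F_char0) => u.
  rewrite -[LHS]/(meval u _) -horner_map eval_partial.
  pose w' p := if [pick q | pos i0 q == p] is Some q then u q else w p.
  apply/eqP/negPn/negP => fu; apply: nPi; exists w', xi.
  apply: contraNneq fu => <-; apply/eqP; apply: meval_eq => j.
  rewrite /hybrid eval_x ltnS; case: (eqVneq j i0) => [->|ne_j].
    rewrite leqnn; apply: meval_eq => l; rewrite /w'.
    by case: pickP => [p /eqP/pos_inj -> //|/(_ l)]; rewrite eqxx.
  have -> : (j <= i)%N = (j < i)%N.
    by rewrite leq_eqVlt -[i]/(val i0) -[nat_of_ord j]/(val j) val_eqE (negPf ne_j).
  case: ifP => // _.
  apply: meval_eq => l; rewrite /v /w'.
  by case: pickP => [p _|_]; rewrite ?mevalXU ?mevalC.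
- move=> j; rewrite /x; case: (ltnP j i) => [ltji|_]; last by left; exists (xi j).
  right; exists (v j), [set p | pos i0 p \in S j]; split=> //.
    have ne_ij : i0 != j by rewrite -val_eqE /= gtn_eqF.
    have [_ /(_ _ _ ne_ij)] := S_design; apply: leq_trans; rewrite ltnS.
    rewrite -(card_imset _ (@pos_inj i0)); apply: subset_leq_card.
    by apply/subsetP => _ /imsetP[p + ->]; rewrite !inE posP => ->.
  move=> l; rewrite /v; case: pickP => [p /eqP pE|_]; last by left; eexists.
  by right; exists p; rewrite // inE pE.
Qed.

End Hybrid.

Section Sparse.

Variables (F : fieldType) (sigma rho d : nat) (g : {mpoly F[sigma]}).
Hypothesis szg : (msize g <= d.+1)%N.

Lemma msize_sparse p : sparse_restriction rho g p -> (msize p <= d.+1)%N.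
Proof.
case=> [[c ->]|[v [V [_ vE ->]]]]; first exact: msize_filtC.
rewrite -[d in X in (_ <= X)%N]muln1.
apply: (filt_mmap (filt_msize _ _)) szg => [c|l]; first exact: msize_filtC.
by case: (vE l) => [[c ->]|[q _ ->]]; [apply: msize_filtC | apply: msize_filtX].
Qed.

Definition sparse_size := polyval_size rho.-1 d 0.

Lemma computable_sparse p (a : 'I_sigma -> F) (t : F) : sparse_restriction rho g p ->
  computable 2 sparse_size (shift_poly a p).[t%:MP].
Proof.
case=> [[c ->]|[v [V [ltV vE ->]]]].
  by rewrite horner_shift mmapC; apply: computable_weaken (computableC _ _).
pose h (l : 'I_#|V|) : {mpoly F[sigma]} := 'X_(enum_val l).
have filth := filt_polyval (@mpolyC sigma F) h (@ideal_zero _).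
have constP c : polyval_mod (@mpolyC sigma F) h (fun x => x = 0) 0 c%:MP.
  exact: polyval_const (@ideal_zero _) _.
have [P szP /eqP] : polyval_mod (@mpolyC sigma F) h (fun x => x = 0) (d * 1)
    (shift_poly a (mmap (@mpolyC sigma F) v g)).[t%:MP].
  rewrite horner_shift rmorph_mmap; apply: (filt_mmap filth _ _ szg) => [c|l] /=.
    by rewrite mmapC; apply: constP.
  case: (vE l) => [[c ->]|[q qV ->]].
    by rewrite mmapC; apply: (filt_leq filth (leq0n _) (constP _)).
  rewrite mmapX mmap1U; apply: (filtD filth).
    exact: (filt_leq filth (leq0n _) (constP _)).
  rewrite -[1%N]add0n; apply: (filtM filth (constP _)).
  rewrite -[q](enum_rankK_in qV qV); exact: polyval_gen (@ideal_zero _) _.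
rewrite subr_eq0 muln1 in szP * => /eqP ->.
apply: computable_weaken (leqnn _) _ (computable_polyval (Delta := 0) (s := 0) szP _).
  rewrite /sparse_size /polyval_size leq_mul2r ltnS; apply/orP; right.
  by case: (d) => // d'; rewrite leq_exp2r // prednK // (leq_ltn_trans _ ltV).
by move=> l; apply: computableX.
Qed.

End Sparse.

(** * Size bounds *)

Section SizeBounds.

Local Open Scope nat_scope.

Lemma leq_add_expn d e1 e2 : (d + 2) ^ e1 + (d + 2) ^ e2 <= (d + 2) ^ (e1 + e2).+1.
Proof.
have d2 : 0 < d + 2 by rewrite addn2.
rewrite expnS; apply: leq_trans (_ : 2 * (d + 2) ^ (e1 + e2) <= _); last first.
  by rewrite leq_mul2r leq_addl orbT.
by rewrite mul2n -addnn leq_add // leq_pexp2l // ?leq_addr ?leq_addl.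
Qed.

Definition poly_bounded (f : nat -> nat) := exists e, forall d, f d <= (d + 2) ^ e.

Lemma poly_bounded_const c : poly_bounded (fun=> c).
Proof.
exists c => d; apply: leq_trans (ltnW (ltn_expl c (isT : 1 < 2))) _.
by case: c => // c; rewrite leq_exp2r // leq_addl.
Qed.

Lemma poly_bounded_id : poly_bounded id.
Proof. by exists 1 => d; rewrite expn1 leq_addr. Qed.

Lemma poly_bounded_add f g :
  poly_bounded f -> poly_bounded g -> poly_bounded (fun d => f d + g d).
Proof.
move=> [e1 fP] [e2 gP]; exists (e1 + e2).+1 => d.
exact: leq_trans (leq_add (fP d) (gP d)) (leq_add_expn _ _ _).
Qed.

Lemma poly_bounded_mul f g :
  poly_bounded f -> poly_bounded g -> poly_bounded (fun d => f d * g d).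
Proof.
by move=> [e1 fP] [e2 gP]; exists (e1 + e2) => d; rewrite expnD leq_mul.
Qed.

Definition KI_bounded (f : nat -> nat -> nat -> nat -> nat -> nat) :=
  exists e, forall s D k rho d, 1 < k -> 1 < rho ->
    f s D k rho d <= KI_size_bound e s D k rho d.

Lemma KI_base_gt1 k rho : 1 < k -> 1 < rho -> 1 < rho * trunc_log 2 k.
Proof.
move=> k1 rho1; have: 0 < trunc_log 2 k by rewrite trunc_log_gt0.
by move/(leq_mul rho1); rewrite muln1.
Qed.

Lemma KI_size_bound_gt1 e s D k rho d : 1 < k -> 1 < rho -> 1 < KI_size_bound e s D k rho d.
Proof.
move=> k1 rho1; have v1 := KI_base_gt1 k1 rho1.
have p1 : 0 < polyb e d by rewrite expn_gt0 addn2.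
rewrite /KI_size_bound -[2]/(1 * 2 ^ 1); apply: leq_mul; first by rewrite expn_gt0 addn2.
by apply: leq_trans (leq_pexp2l _ p1) _ => //; rewrite leq_exp2r.
Qed.

Lemma KI_bounded_mul f g : KI_bounded f -> KI_bounded g ->
  KI_bounded (fun s D k rho d => f s D k rho d * g s D k rho d).
Proof.
move=> [e1 fP] [e2 gP]; exists (e1 + e2).+1 => s D k rho d k1 rho1.
apply: leq_trans (leq_mul (fP s D k rho d k1 rho1) (gP s D k rho d k1 rho1)) _.
have v1 := KI_base_gt1 k1 rho1; rewrite /KI_size_bound /polyb mulnACA -!expnD.
apply: leq_mul; first by rewrite leq_pexp2l ?addn2.
by rewrite leq_pexp2l ?leq_add_expn // ltnW.
Qed.

Lemma KI_bounded_leq f g : KI_bounded g ->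
  (forall s D k rho d, 1 < k -> 1 < rho -> f s D k rho d <= g s D k rho d) -> KI_bounded f.
Proof.
move=> [e gP] fg; exists e => s D k rho d k1 rho1.
exact: leq_trans (fg _ _ _ _ _ k1 rho1) (gP _ _ _ _ _ k1 rho1).
Qed.

Lemma KI_bounded_add f g : KI_bounded f -> KI_bounded g ->
  KI_bounded (fun s D k rho d => f s D k rho d + g s D k rho d).
Proof.
move=> [e1 fP] [e2 gP].
apply: (@KI_bounded_leq _ (fun s D k rho d =>
  KI_size_bound e1 s D k rho d * KI_size_bound e2 s D k rho d)).
  by apply: KI_bounded_mul; [exists e1 | exists e2].
move=> s D k rho d k1 rho1.
apply: leq_trans (leq_add (fP s D k rho d k1 rho1) (gP s D k rho d k1 rho1)) _.
have := KI_size_bound_gt1 e1 s D d k1 rho1; have := KI_size_bound_gt1 e2 s D d k1 rho1.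
by move: (KI_size_bound _ _ _ _ _ _) (KI_size_bound _ _ _ _ _ _) => u v; nia.
Qed.

Lemma KI_bounded_exp f g : poly_bounded f -> poly_bounded g ->
  KI_bounded (fun s D k rho d => f d ^ g d).
Proof.
move=> fP gP; have [e fgP] := poly_bounded_mul fP gP.
exists e => s D k rho d k1 rho1; have v1 := KI_base_gt1 k1 rho1.
rewrite /KI_size_bound -[X in X <= _]mul1n; apply: leq_mul; first by rewrite expn_gt0 addn2.
apply: leq_trans (_ : 2 ^ (f d * g d) <= _).
  rewrite expnM; case: (g d) => // g'; rewrite leq_exp2r //; exact: ltnW (ltn_expl _ _).
apply: leq_trans (_ : 2 ^ polyb e d <= _); first by rewrite leq_pexp2l.
by rewrite leq_exp2r // expn_gt0 addn2.
Qed.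

Lemma KI_bounded_poly f : poly_bounded f -> KI_bounded (fun s D k rho d => f d).
Proof.
move=> fP; have := KI_bounded_exp fP (poly_bounded_const 1).
by move/KI_bounded_leq; apply=> *; rewrite expn1.
Qed.

Lemma KI_bounded_const c : KI_bounded (fun _ _ _ _ _ => c).
Proof. exact: KI_bounded_poly (poly_bounded_const c). Qed.

Lemma KI_bounded_base : KI_bounded (fun s D k rho d => s + D + k + 2).
Proof.
exists 1 => s D k rho d k1 rho1; have v1 := KI_base_gt1 k1 rho1.
by rewrite /KI_size_bound /polyb !expn1 leq_pmulr // expn_gt0 ltnW.
Qed.

Lemma KI_bounded_rho : KI_bounded (fun s D k rho d => rho ^ d).
Proof.
exists 1 => s D k rho d k1 rho1; have v1 := KI_base_gt1 k1 rho1.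
rewrite /KI_size_bound -[X in X <= _]mul1n; apply: leq_mul; first by rewrite expn_gt0 addn2.
have log1 : 0 < trunc_log 2 k by rewrite trunc_log_gt0.
apply: leq_trans (_ : (rho * trunc_log 2 k) ^ d <= _).
  by case: d => // d; rewrite leq_exp2r // leq_pmulr.
by apply: leq_pexp2l; [apply: ltnW | rewrite /polyb expn1 leq_addr].
Qed.

Lemma KI_bounded_S f : KI_bounded f -> KI_bounded (fun s D k rho d => (f s D k rho d).+1).
Proof.
move=> fP; apply: KI_bounded_leq (KI_bounded_add (KI_bounded_const 1) fP) _.
by move=> *; rewrite add1n.
Qed.

Lemma KI_bounded_polyval N r f : poly_bounded N -> poly_bounded r -> KI_bounded f ->
  KI_bounded (fun s D k rho d => polyval_size (N d) (r d) (f s D k rho d)).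
Proof.
move=> NP rP fP.
have NP' : poly_bounded (fun d => (N d).+1).
  by have [e eP] := poly_bounded_add (poly_bounded_const 1) NP; exists e.
have rP' : poly_bounded (fun d => (r d).+2).
  by have [e eP] := poly_bounded_add (poly_bounded_const 2) rP; exists e.
apply: KI_bounded_mul; first by apply: KI_bounded_S; apply: KI_bounded_exp.
apply: KI_bounded_S; apply: KI_bounded_mul; last exact: KI_bounded_S.
exact: KI_bounded_poly.
Qed.

Lemma KI_bounded_lincomb N f : KI_bounded N -> KI_bounded f ->
  KI_bounded (fun s D k rho d => lincomb_size (N s D k rho d) (f s D k rho d)).
Proof.
move=> NP fP; apply: KI_bounded_mul.
  apply: KI_bounded_S; apply: KI_bounded_leq (KI_bounded_S NP) _.
  by move=> *; rewrite expn1.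
apply: KI_bounded_S; apply: KI_bounded_mul; last exact: KI_bounded_S.
exact: KI_bounded_const.
Qed.

Definition total_size s D k rho d :=
  extraction_size (D * (k.*2 * D).+1) d (root_coef_size D k d s (sparse_size rho d)).

Lemma KI_bounded_total_size : KI_bounded total_size.
Proof.
have bs : KI_bounded (fun s D k rho d => s) by apply: KI_bounded_leq KI_bounded_base _; lia.
have bD : KI_bounded (fun s D k rho d => D) by apply: KI_bounded_leq KI_bounded_base _; lia.
have bk : KI_bounded (fun s D k rho d => k) by apply: KI_bounded_leq KI_bounded_base _; lia.
have pd := poly_bounded_id.
have pdS : poly_bounded S.
  by have [e eP] := poly_bounded_add (poly_bounded_const 1) pd; exists e.
have pdSS : poly_bounded (fun d => d.+2).
  by have [e eP] := poly_bounded_add (poly_bounded_const 2) pd; exists e.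
have pdd : poly_bounded double.
  have [e eP] := poly_bounded_add pd pd.
  by exists e => d; rewrite -addnn; apply: eP.
have bd : KI_bounded (fun s D k rho d => d) := KI_bounded_poly pd.
have bdd : KI_bounded (fun s D k rho d => d.*2) := KI_bounded_poly pdd.
have bkk : KI_bounded (fun s D k rho d => k.*2).
  by apply: KI_bounded_leq (KI_bounded_add bk bk) _ => *; rewrite addnn.
have pM : poly_bounded (fun d => d.+1 * d.+1) by apply: poly_bounded_mul.
have bsparse : KI_bounded (fun s D k rho d => sparse_size rho d).
  apply: KI_bounded_mul.
    apply: KI_bounded_S; apply: KI_bounded_leq KI_bounded_rho _.
    by move=> s D k rho d _ rho1; rewrite prednK // ltnW.
  apply: KI_bounded_S; apply: KI_bounded_mul; last exact: KI_bounded_const.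
  exact: KI_bounded_poly.
apply: KI_bounded_mul; last exact: KI_bounded_const.
apply: KI_bounded_S; apply: KI_bounded_polyval => //.
apply: KI_bounded_lincomb; first exact: KI_bounded_const.
apply: KI_bounded_lincomb; first exact: KI_bounded_S.
apply: KI_bounded_lincomb.
  by apply/KI_bounded_S/KI_bounded_mul => //; apply/KI_bounded_S/KI_bounded_mul.
apply: KI_bounded_lincomb.
  by apply/KI_bounded_S/KI_bounded_mul => //; apply/KI_bounded_S.
apply: KI_bounded_polyval => //; first exact: poly_bounded_mul.
apply: KI_bounded_lincomb => //.
apply: KI_bounded_lincomb.
  apply/KI_bounded_S/KI_bounded_mul => //; apply: KI_bounded_add => //.
  by apply: KI_bounded_mul => //; apply: KI_bounded_S.
apply: KI_bounded_polyval => //.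
apply: KI_bounded_lincomb; first exact: KI_bounded_const.
apply: KI_bounded_lincomb; first by apply/KI_bounded_S/KI_bounded_mul.
apply: KI_bounded_lincomb; first exact: KI_bounded_S.
by apply: KI_bounded_mul; apply: KI_bounded_S.
Qed.

End SizeBounds.

Lemma subst_root_genE (F : fieldType) n mu (A : {mpoly F[n.+2]})
    (Phi : {poly {mpoly F[n]}}) (G : n.-tuple {mpoly F[mu]}) :
  subst_root_gen A Phi G = map_poly (fun p => p \mPo G) (subst_root A Phi).
Proof.
rewrite /subst_root [RHS](rmorph_subst3 (map_poly (comp_mpoly G))).
apply: eq_subst3 => [c||i|] //=; rewrite ?map_polyX // map_polyC /=.
  by rewrite comp_mpolyC.
by rewrite comp_mpolyXU -tnth_nth.
Qed.

Lemma mpoly_tdeg0 (F : fieldType) m (p : {mpoly F[m]}) :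
  tdeg p = 0%N -> computable 0 0 p.
Proof.
rewrite /tdeg => p0; rewrite [p]msize1_polyC; first exact: computableC.
by case: (msize p) p0 => // -[].
Qed.

Section GeneratorComputable.

Variables (F : fieldType) (n k Delta s sigma mu rho : nat).
Variables (A : {mpoly F[n.+2]}) (Phi : {poly {mpoly F[n]}}).
Variables (S : 'I_n -> {set 'I_mu}) (g : {mpoly F[sigma]}).
Hypothesis F_char0 : [pchar F] =i pred0.
Hypothesis k_gt1 : (1 < k)%N.
Hypothesis compA : computable Delta s A.
Hypothesis A_reg : T_regularized A.
Hypothesis Phi_trunc : truncated_root k Phi.
Hypothesis Phi_nondeg : nondegenerate_root A Phi.
Hypothesis Phi_root : approx_root k A Phi.
Hypothesis S_design : design sigma rho S.
Hypothesis APhi_neq0 : subst_root A Phi != 0.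
Hypothesis APhi_KI : subst_root_gen A Phi (KI g S) = 0.

Lemma generator_computable :
  computable 0 0 g \/
  (1 < rho)%N /\ computable (Delta + 27) (total_size s (tdeg A) k rho (tdeg g)) g.
Proof.
have k_gt0 := ltnW k_gt1.
pose j0 := (size (subst_root A Phi)).-1; pose f := (subst_root A Phi)`_j0.
have f_neq0 : f != 0 by rewrite -[f]/(lead_coef _) lead_coef_eq0.
have f_KI : f \mPo KI g S = 0.
  have /polyP/(_ j0) := APhi_KI; rewrite subst_root_genE coef0.
  by rewrite (coef_map (comp_mpoly (KI g S))).
have [i0 [x [fy_neq0 fy_root x_sparse]]] := hybrid_argument F_char0 S_design f_neq0 f_KI.
have [rho_le1|rho_gt1] := leqP rho 1.
  left; have xC j : x j = ((x j).@[fun=> 0])%:MP.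
    case: (x_sparse j) => [[c ->]|[v [V [ltV vE ->]]]]; first by rewrite mevalC.
    have V0 : V = set0.
      by apply/eqP; rewrite -cards_eq0 -leqn0 -ltnS (leq_trans ltV).
    rewrite (eq_mmap (iota' := @mpolyC sigma F) (v' := fun l => ((v l).@[fun=> 0])%:MP)) //.
      pose ev0 : {rmorphism _ -> {mpoly F[sigma]}} := @mpolyC sigma F.
      by rewrite -[mmap _ _ _](rmorph_mmap ev0 idfun) /= mevalC.
    move=> l; case: (vE l) => [[c ->]|[p]]; first by rewrite mevalC.
    by rewrite V0 inE.
  pose P : {poly F} := mmap polyC
    (fun j => if j == i0 then 'X else ((x j).@[fun=> 0])%:P) f.
  have PE : partial_subst f i0 x = map_poly (@mpolyC sigma F) P.
    rewrite [RHS]rmorph_mmap; apply: eq_mmap => [c|j] /=; first by rewrite map_polyC.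
    by case: eqP => _; rewrite ?map_polyX // map_polyC /= -xC.
  have P_neq0 : P != 0 by apply: contraNneq fy_neq0 => P0; rewrite PE P0 rmorph0.
  rewrite (@algebraic_mpolyC _ F_char0 _ P g P_neq0); first exact: computableC.
  by rewrite -PE.
have [tdeg0|tdeg_gt0] := posnP (tdeg g); first by left; apply: mpoly_tdeg0.
right; split=> //; set d := tdeg g in tdeg_gt0 *.
have szg : (msize g <= d.+1)%N := leqSpred _.
rewrite -[27%N]/(18 + 9)%N addnA; apply: (computable_root F_char0 _ szg fy_neq0 fy_root).
  exact: msize_subst_root_coef.
move=> a y nu b lebd.
apply: (computable_weaken (Delta := ((2 + Delta) + 16)%N) _ (leqnn _)); first by lia.
have X0 j : (line_point i0 x a y nu j)`_0 = (if j == i0 then y else (x j).@[a])%:MP.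
  rewrite /line_point; case: eqP => _; last exact: coef0_shift.
  by rewrite coefD coefCM coefX mulr0 addr0 coefC.
apply: (computable_at_X F_char0 A_reg Phi_nondeg Phi_root Phi_trunc k_gt0 X0 compA) => //.
- move=> j; rewrite /line_point; case: eqP => _.
    apply: (filtD (filt_size _)); first exact: size_filtC.
    rewrite -[d]add0n; apply: (filtM (filt_size _)); first exact: size_filtC.
    exact: size_filtX.
  by apply: size_shift; apply: msize_sparse (x_sparse j).
- move=> j t; rewrite /line_point; case: eqP => _; last first.
    by apply: (computable_sparse szg); apply: x_sparse.
  rewrite !hornerE -mpolyCM -mpolyCD.
  by apply: computable_weaken (computableC _ _).
Qed.

End GeneratorComputable.

Theorem theorem7p2 :
  exists c e : nat,
  forall (F : fieldType) (n k Delta s sigma mu rho d : nat)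
    (A : {mpoly F[n.+2]}) (Phi : {poly {mpoly F[n]}})
    (S : 'I_n -> {set 'I_mu}) (g : {mpoly F[sigma]}),
  [pchar F] =i pred0 ->
  (1 < k)%N ->
  computable Delta s A ->
  T_regularized A -> monic_in_z A ->
  truncated_root k Phi -> nondegenerate_root A Phi -> approx_root k A Phi ->
  design sigma rho S ->
  tdeg g = d ->
  let Delta' := (Delta + c)%N in
  let s' := KI_size_bound e s (tdeg A) k rho d in
  (subst_root A Phi != 0 ->
   subst_root_gen A Phi (KI g S) = 0 ->
   computable Delta' s' g)
  /\
  (~ computable Delta' s' g ->
   (subst_root_gen A Phi (KI g S) = 0 <-> subst_root A Phi = 0)).
Proof.
have [e leqe] := KI_bounded_total_size.
exists 27, e => F n k Delta s sigma mu rho d A Phi S g F_char0 k_gt1 compA A_reg _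
  Phi_trunc Phi_nondeg Phi_root S_design degg Delta' s'.
have main : subst_root A Phi != 0 -> subst_root_gen A Phi (KI g S) = 0 ->
    computable Delta' s' g.
  move=> APhi_neq0 APhi_KI.
  have [compg|[rho_gt1 compg]] := generator_computable F_char0 k_gt1 compA A_reg
    Phi_trunc Phi_nondeg Phi_root S_design APhi_neq0 APhi_KI.
    exact: computable_weaken compg.
  by apply: computable_weaken compg => //; rewrite degg; apply: leqe.
split=> // ncomp; split=> [APhi_KI|APhi0].
  by apply/eqP/negPn/negP => /main/(_ APhi_KI).
by rewrite subst_root_genE APhi0 (rmorph0 (map_poly (comp_mpoly (KI g S)))).
Qed.
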